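(* Let $A>0$ be a fixed area, let $\Omega_0\subset\mathbb{R}^2$ be a square of area $A$, and fix $\alpha<0$. Then there exists a constant $C$, depending only on $\alpha$ (and on the fixed area $A$), such that for every quadrilateral $\Omega\subset\mathbb{R}^2$ of area $A$ with $d_H(\Omega,\Omega_0)>C$ we have $\lambda_1(\Omega,\alpha)\le\lambda_1(\Omega_0,\alpha)$.
   Context: For a bounded polygonal domain $\Omega\subset\mathbb{R}^2$ and $\alpha\in\mathbb{R}$, $\lambda_1(\Omega,\alpha)$ denotes the first eigenvalue of the Robin problem $-\Delta u=\lambda u$ in $\Omega$, $\frac{\partial u}{\partial\nu}+\alpha u=0$ on $\partial\Omega$ ($\nu$ the outward unit normal), given by $$\lambda_1(\Omega,\alpha)=\min_{u\in H^1(\Omega),\,u\ne0}\frac{\int_\Omega|\nabla u|^2\,dx+\alpha\int_{\partial\Omega}|u|^2\,d\sigma}{\int_\Omega|u|^2\,dx},$$ with the boundary integral understood in the sense of traces. A quadrilateral is the (open) interior region of a simple four-sided polygon, not necessarily convex. $d_H(\Omega,\Omega_0)$ is the Hausdorff distance up to isometry, i.e. the infimum over isometries $T$ of $\mathbb{R}^2$ of the Hausdorff distance between (the closures of) $\Omega$ and $T(\Omega_0)$. *)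

(* Defs.v *)
From HB Require Import structures.
From mathcomp Require Import all_boot all_order all_algebra.
From mathcomp Require Import all_classical all_reals all_analysis.
Set Implicit Arguments.
Unset Strict Implicit.
Unset Printing Implicit Defensive.
Import Order.TTheory GRing.Theory Num.Theory.
Import numFieldNormedType.Exports.
Local Open Scope classical_set_scope.
Local Open Scope ring_scope.

(* The library norm on [R * R] is the max norm: it is used only for the topology
   and for boundedness; lengths and distances go through [enorm]. *)

Notation lebesgue2 R :=
  (@lebesgue_measure R \x @lebesgue_measure R)%E.

Section Plane.
Context {R : realType}.
Implicit Types (p q x y : R * R) (S T : set (R * R)).

Definition dot p q : R := p.1 * q.1 + p.2 * q.2.
Definition enorm p : R := Num.sqrt (dot p p).
Definition eucl_dist p q : R := enorm (p - q).

Definition plane_isometry (f : R * R -> R * R) : Prop :=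
  forall x y, eucl_dist (f x) (f y) = eucl_dist x y.

Definition hausdorff_dist S T : \bar R :=
  maxe (ereal_sup [set ereal_inf [set (eucl_dist x y)%:E | y in T] | x in S])
       (ereal_sup [set ereal_inf [set (eucl_dist x y)%:E | x in S] | y in T]).

Definition hausdorff_dist_iso S T : \bar R :=
  ereal_inf [set hausdorff_dist (closure S) (closure (f @` T)) | f in plane_isometry].

End Plane.

(* A polygon is given by its vertices in cyclic order; [ordS] is the cyclic
   successor on ['I_n]. *)
Section Polygon.
Context {R : realType} {n : nat}.
Implicit Types (v : 'I_n -> R * R).

Definition side v (i : 'I_n) : R * R := v (ordS i) - v i.
Definition side_pt v (i : 'I_n) (s : R) : R * R := v i + s *: side v i.
Definition edge v (i : 'I_n) : set (R * R) := side_pt v i @` `[0, 1].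
Definition poly_boundary v : set (R * R) := \bigcup_i edge v i.

(* Straight angles at a vertex are allowed; zero angles are excluded since
   consecutive edges share only their common vertex. *)
Definition simple_polygon v : Prop :=
  [/\ injective v,
      forall i, edge v i `&` edge v (ordS i) = [set v (ordS i)] &
      forall i j, j != i -> j != ordS i -> i != ordS j ->
        edge v i `&` edge v j = set0].

(* The interior region of the Jordan curve [poly_boundary v]: the points whose
   connected component in the complement of the curve is bounded. *)
Definition poly_region v : set (R * R) :=
  [set x | (~` poly_boundary v) x /\
           bounded_set (connected_component (~` poly_boundary v) x)].

Definition poly_area v : \bar R := lebesgue2 R (poly_region v).

(* Arc-length integral over the boundary of the polygon. *)
Definition boundary_integral v (f : R * R -> R) : \bar R :=
  (\sum_(i < n) (enorm (side v i))%:E *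
     \int[@lebesgue_measure R]_(s in `[0%R, 1%R]) (f (side_pt v i s))%:E)%E.

End Polygon.

Definition is_square {R : realType} (v : 'I_4 -> R * R) : Prop :=
  [/\ simple_polygon v,
      forall i j, enorm (side v i) = enorm (side v j) &
      forall i, dot (side v i) (side v (ordS i)) = 0].

Section Sobolev.
Context {R : realType}.
Implicit Types (D : set (R * R)) (u f phi t : R * R -> R).
Implicit Types (g : R * R -> R * R).

Definition partial1 f (x : R * R) : R := 'D_((1, 0) : R * R) f x.
Definition partial2 f (x : R * R) : R := 'D_((0, 1) : R * R) f x.

Fixpoint Ck (k : nat) f : Prop :=
  match k with
  | 0%N => continuous f
  | k'.+1 => [/\ continuous f,
                forall x, derivable f x ((1, 0) : R * R),
                forall x, derivable f x ((0, 1) : R * R),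
                Ck k' (partial1 f) & Ck k' (partial2 f)]
  end.

Definition smooth f : Prop := forall k, Ck k f.

Definition test_function D phi : Prop :=
  let supp := closure [set x | phi x != 0] in
  [/\ smooth phi, compact supp & supp `<=` D].

Definition sq_integral D f : \bar R :=
  (\int[lebesgue2 R]_(x in D) ((f x) ^+ 2)%:E)%E.

Definition in_L2 D f : Prop :=
  measurable_fun D f /\ (sq_integral D f < +oo)%E.

Definition weak_gradient D u g : Prop :=
  forall phi, test_function D phi ->
    (\int[lebesgue2 R]_(x in D) (u x * partial1 phi x)%:E =
       - \int[lebesgue2 R]_(x in D) ((g x).1 * phi x)%:E)%E /\
    (\int[lebesgue2 R]_(x in D) (u x * partial2 phi x)%:E =
       - \int[lebesgue2 R]_(x in D) ((g x).2 * phi x)%:E)%E.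

(* [u] is in H^1(D), with weak gradient [g]. *)
Definition in_H1 D u g : Prop :=
  [/\ in_L2 D u, in_L2 D (fst \o g), in_L2 D (snd \o g) & weak_gradient D u g].

Definition in_L2_boundary {n : nat} (v : 'I_n -> R * R) t : Prop :=
  (forall i, measurable_fun (`[0%R, 1%R]%classic : set R) (t \o side_pt v i)) /\
  (boundary_integral v (fun x => (t x) ^+ 2)%R < +oo)%E.

(* [t] is the trace on the boundary of the polygon [v] of the H^1 function [u]
   with weak gradient [g].  The trace operator is the continuous extension to
   H^1 of the restriction to the boundary of functions smooth up to the
   boundary (these are dense in H^1 of a simple polygon): [t] is the L^2 limit
   on the boundary of smooth functions converging to [u] in H^1. *)
Definition is_trace {n : nat} (v : 'I_n -> R * R) u g t : Prop :=
  in_L2_boundary v t /\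
  exists w : nat -> R * R -> R,
    [/\ forall k, smooth (w k),
        sq_integral (poly_region v) (fun x => w k x - u x) @[k --> \oo]
          --> 0%E,
        sq_integral (poly_region v) (fun x => partial1 (w k) x - (g x).1)
          @[k --> \oo] --> 0%E,
        sq_integral (poly_region v) (fun x => partial2 (w k) x - (g x).2)
          @[k --> \oo] --> 0%E &
        boundary_integral v (fun x => (w k x - t x) ^+ 2)
          @[k --> \oo] --> 0%E].

(* The integrals are finite wherever this is used, so [fine] loses nothing. *)
Definition rayleigh_quotient {n : nat} (v : 'I_n -> R * R) (alpha : R)
    u g t : R :=
  (fine (\int[lebesgue2 R]_(x in poly_region v) (enorm (g x) ^+ 2)%:E)%E
     + alpha * fine (boundary_integral v (fun x => (t x) ^+ 2)))
  / fine (sq_integral (poly_region v) u).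

(* First Robin eigenvalue of the interior region of a simple polygon.  The
   minimum is taken as an infimum in the extended reals (it is attained, the
   region being bounded with Lipschitz boundary), so that neither a minimizer
   nor a lower bound is presupposed. *)
Definition robin_lambda1 {n : nat} (v : 'I_n -> R * R) (alpha : R) : \bar R :=
  ereal_inf [set r : \bar R | exists u g t,
    [/\ in_H1 (poly_region v) u g, is_trace v u g t,
        ~ {ae lebesgue2 R, forall x, poly_region v x -> u x = 0} &
        r = (rayleigh_quotient v alpha u g t)%:E]].

End Sobolev.

(* Main.v *)
From HB Require Import structures.
Require Import Defs.
From mathcomp Require Import all_boot all_order all_algebra.
From mathcomp Require Import all_classical all_reals all_analysis.
From mathcomp Require Import measurable_realfun ring lra.

(** A region of fixed area that is far from the square in Hausdorff distance is
    long, hence has a large perimeter [P]; testing the Rayleigh quotient with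
    the constant function 1 gives [lambda1 <= alpha * P / A], which tends to
    minus infinity with [P] because [alpha < 0].  So the theorem only asks for
    a lower bound on [lambda1] of the square in terms of [alpha] and [A].

    Test function ([robin_lambda1_le]): the constant 1 has zero weak gradient
    because the partial derivatives of a test function integrate to 0
    ([test_function_partial_integral]), and it is its own trace.

    Distance against perimeter: a point farther from a vertex than the
    perimeter escapes to infinity along a ray without meeting the polygon
    ([poly_region_dist]), so the region has diameter at most [2 * P] for
    the max norm; a translation making two regions overlap then bounds their
    Hausdorff distance by their diameters ([hausdorff_dist_iso_le]).

    The square ([square_robin_lambda1_ge]): let [a] be the side.  On a segment
    of length [a] going into the square from a boundary point, the fundamental
    theorem of calculus and the arithmetic-geometric inequality bound the square
    of the boundary value by the integrals of [w ^+ 2] and [|grad w| ^+ 2], the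
    latter with an arbitrarily small weight [eta] ([trace_on_segment]).
    Integrating along a side amounts to integrating over the square, by the
    linear change of variables in the plane ([ge0_integral_parallelogram]).
    Summing over the sides and passing to the limit along the smooth
    approximations that define the trace gives the trace inequality
    ([square_trace]); choosing [eta] so that the gradient term is absorbed by
    the Dirichlet energy leaves a lower bound depending on [alpha] and [a].
    Finally [a] is comparable to the square root of [A] ([square_side_area]).

    The region of a polygon is defined through connected components of the
    complement of the curve.  For the square, the argument goes through the
    inclusion in it of the open parallelogram spanned at each corner
    ([square_interior_sub]), obtained from connectedness. *)

Import Order.TTheory GRing.Theory Num.Theory.
Import numFieldNormedType.Exports.
Set Implicit Arguments.
Unset Strict Implicit.
Unset Printing Implicit Defensive.
Local Open Scope ring_scope.

(** * Lebesgue measure and affine maps of the plane *)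

Section PlaneMeasure.
Context {R : realType}.
Local Open Scope classical_set_scope.
Local Notation mu := (@lebesgue_measure R).

Lemma measurable_ball2 (x : R * R) (e : R) : measurable (ball x e).
Proof.
rewrite (_ : ball x e = ball x.1 e `*` ball x.2 e); last by [].
by apply: measurableX; rewrite ball_itv; exact: measurable_itv.
Qed.

(** An open set is the union of the balls it contains whose centre is rational
    and whose radius is of the form [1 / k.+1]; there are countably many of
    them, and each is a product of two intervals. *)
Lemma open_measurable2 (U : set (R * R)) : open U -> measurable U.
Proof.
move=> oU.
pose c (q : rat * rat) : R * R := (ratr q.1, ratr q.2).
pose F (z : rat * rat * nat) : set (R * R) :=
  if asbool (ball (c z.1) z.2.+1%:R^-1 `<=` U)
  then ball (c z.1) z.2.+1%:R^-1 else set0.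
rewrite (_ : U = \bigcup_z F z); last first.
  apply/seteqP; split => [x Ux|x [z _]]; last first.
    by rewrite /F; case: asboolP => // zU /zU.
  have /nbhs_ballP[e /= e0 eU] : nbhs x U by exact: open_nbhs_nbhs.
  have [k ke] : exists k : nat, k.+1%:R^-1 < e / 2.
    exists (Num.trunc (e / 2)^-1).
    by rewrite invf_plt ?posrE ?divr_gt0// truncnS_gt.
  have k0 : 0 < k.+1%:R^-1 :> R by rewrite invr_gt0.
  have rat_near (y : R) : exists q : rat, ball y k.+1%:R^-1 (ratr q).
    have yk : y - k.+1%:R^-1 < y + k.+1%:R^-1 by move: k0; set d := _^-1; lra.
    have [q] := rat_in_itvoo yk.
    rewrite in_itv/= => /andP[q1 q2]; exists q.
    by rewrite -ball_normE /ball_/= distrC ltr_distl q1 q2.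
  have [q1 xq1] := rat_near x.1.
  have [q2 xq2] := rat_near x.2.
  have xq : ball (c (q1, q2)) k.+1%:R^-1 x.
    by apply: ball_sym; split.
  exists ((q1, q2), k) => //; rewrite /F; case: asboolP => //= -[].
  move=> y qy; apply: eU.
  have -> : e = e / 2 + e / 2 by rewrite -splitr.
  apply: (@ball_triangle _ _ (c (q1, q2))).
    by apply: ball_sym; apply: le_ball xq; exact: ltW.
  by apply: le_ball qy; exact: ltW.
apply: countable_bigcupT_measurable => [|z]; first exact: countableP.
rewrite /F.
by case: asboolP => _; [exact: measurable_ball2|exact: measurable0].
Qed.

Lemma continuous_measurable2 (f : R * R -> R) :
  continuous f -> measurable_fun setT f.
Proof.
move=> cf; apply: (measurability _ (RGenOpens.measurableE R)).
move=> _ [_ [a [b ->] <-]]; rewrite setTI; apply: open_measurable2.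
by move/continuousP : cf; apply; exact: interval_open.
Qed.

(** By uniqueness of Lebesgue measure it is enough to compare the two measures
    on half-open intervals.  A negative slope exchanges the open and the closed
    endpoint, which costs nothing in length. *)
Lemma lebesgue_measure_affine (k b : R) (A : set R) : k != 0 -> measurable A ->
  mu A = (`|k|%:E * mu ((fun x => k * x + b)%R @^-1` A))%E.
Proof.
move=> k0 mA.
pose phi : measurableTypeR R -> measurableTypeR R := fun x => k * x + b.
have mphi : measurable_fun setT phi.
  by apply: measurable_funD => //; exact: measurable_funM.
apply: (@lebesgue_measure_unique R
  (mscale (NngNum (normr_ge0 k)) (pushforward mu phi))) => //= _ [[x y]] _ <-.
rewrite /mscale /= /pushforward /phi.
case: (ltgtP k 0) k0 => // kgt _.
  rewrite (_ : _ @^-1` _ = `[(y - b) / k, (x - b) / k[%classic); last first.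
    apply/seteqP; split => z /=; rewrite !in_itv/= => /andP[z1 z2].
      by rewrite ler_ndivrMr// ltr_ndivlMr//; apply/andP; split; nra.
    move: z1 z2; rewrite ler_ndivrMr// ltr_ndivlMr// => z1 z2.
    by apply/andP; split; nra.
  rewrite !lebesgue_measure_itv/= !lte_fin.
  rewrite ltr_nM2r ?invr_lt0// ltrD2r; case: ifPn => _; last by rewrite mule0.
  by rewrite -EFinM ltr0_norm//; congr EFin; field; lra.
rewrite (_ : _ @^-1` _ = `](x - b) / k, (y - b) / k]%classic); last first.
  apply/seteqP; split => z /=; rewrite !in_itv/= => /andP[z1 z2].
    by rewrite ltr_pdivrMr// ler_pdivlMr//; apply/andP; split; nra.
  move: z1 z2; rewrite ltr_pdivrMr// ler_pdivlMr// => z1 z2.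
  by apply/andP; split; nra.
rewrite !lebesgue_measure_itv/= !lte_fin.
rewrite ltr_pM2r ?invr_gt0// ltrD2r; case: ifPn => _; last by rewrite mule0.
by rewrite -EFinM gtr0_norm//; congr EFin; field; lra.
Qed.

Lemma ge0_integral_affine (k b : R) (f : R -> \bar R) : k != 0 ->
  measurable_fun setT f -> (forall x, 0 <= f x)%E ->
  (\int[mu]_x f x = `|k|%:E * \int[mu]_x f (k * x + b)%R)%E.
Proof.
move=> k0 mf f0.
pose phi : measurableTypeR R -> measurableTypeR R := fun x => k * x + b.
have mphi : measurable_fun setT phi.
  by apply: measurable_funD => //; exact: measurable_funM.
rewrite (eq_measure_integral
    (mscale (NngNum (normr_ge0 k)) (pushforward mu phi))) //; last first.
  by move=> A mA _; rewrite [LHS](lebesgue_measure_affine b k0 mA).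
rewrite ge0_integral_mscale//; congr (_ * _)%E.
by rewrite ge0_integral_pushforward.
Qed.

Local Notation mu2 := (lebesgue2 R).

Lemma affine2E (p e e' : R * R) (s r : R) : p + s *: e + r *: e' =
  (p.1 + s * e.1 + r * e'.1, p.2 + s * e.2 + r * e'.2).
Proof. by []. Qed.

Lemma measurable_affine2 (p e e' : R * R) :
  measurable_fun [set: R * R] (fun z => p + z.1 *: e + z.2 *: e').
Proof.
apply/measurable_fun_pairP; split.
  apply: (measurable_funD (f := fun z : R * R => p.1 + z.1 * e.1)
    (g := fun z : R * R => z.2 * e'.1)).
    by apply: measurable_funD => //; exact: measurable_funM.
  exact: measurable_funM.
apply: (measurable_funD (f := fun z : R * R => p.2 + z.1 * e.2)
  (g := fun z : R * R => z.2 * e'.2)).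
  by apply: measurable_funD => //; exact: measurable_funM.
exact: measurable_funM.
Qed.

Lemma integral_affine2C (p e e' : R * R) (F : R * R -> \bar R) :
  measurable_fun setT F -> (forall x, 0 <= F x)%E ->
  (\int[mu]_s \int[mu]_r F (p + s *: e + r *: e')%R =
   \int[mu]_r \int[mu]_s F (p + s *: e + r *: e')%R)%E.
Proof.
move=> mF F0.
have mT : measurable_fun setT (fun z : R * R => F (p + z.1 *: e + z.2 *: e')).
  by apply: measurableT_comp mF _; exact: measurable_affine2.
exact: (fubini_tonelli (m1 := mu) (m2 := mu)
  (fun z : R * R => F (p + z.1 *: e + z.2 *: e'))).
Qed.

(** Two affine substitutions on the line, with Tonelli in between: for fixed [r]
    the first coordinate [x = p.1 + s * e.1 + r * e'.1] replaces [s]; for fixed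
    [x] the second coordinate is then affine in [r] with slope [det / e.1]. *)
Lemma ge0_integral_affine2_neq0 (p e e' : R * R) (F : R * R -> \bar R) :
  e.1 != 0 -> e.1 * e'.2 - e.2 * e'.1 != 0 ->
  measurable_fun setT F -> (forall x, 0 <= F x)%E ->
  (\int[mu2]_x F x = `|e.1 * e'.2 - e.2 * e'.1|%:E *
     \int[mu]_s \int[mu]_r F (p + s *: e + r *: e')%R)%E.
Proof.
move=> e10; set det := _ - _ => det0 mF F0.
rewrite integral_affine2C//.
pose H r x := F (x, p.2 + (x - p.1) / e.1 * e.2 + r * (det / e.1)).
have mH : measurable_fun [set: R * R] (fun z : R * R => H z.1 z.2).
  apply: measurableT_comp mF _; apply: measurable_fun_pair => //.
  by do 5 (apply: measurable_funD || apply: measurable_funM ||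
           apply: measurable_funB) => //.
have H0 (z : R * R) : (0 <= H z.1 z.2)%E by exact: F0.
have inner r : (\int[mu]_s F (p + s *: e + r *: e')%R =
    `|e.1|^-1%:E * \int[mu]_x H r x)%E.
  rewrite (@ge0_integral_affine e.1 (p.1 + r * e'.1) (H r))//; last 2 first.
    exact: (measurableT_comp mH (pair1_measurable r)).
    by move=> x; exact: F0.
  rewrite muleA -EFinM mulVf ?normr_eq0// mul1e.
  apply: eq_integral => s _; rewrite /H affine2E; congr F.
  by congr pair; [ring|rewrite /det; field].
have -> : (\int[mu]_r \int[mu]_s F (p + s *: e + r *: e')%R =
    \int[mu]_r (`|e.1|^-1%:E * \int[mu]_x H r x))%E.
  by apply: eq_integral => r _; exact: inner.
rewrite ge0_integralZl//; last 2 first.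
  exact: (measurable_fun_fubini_tonelli_F (m2 := mu) _ mH H0).
  by move=> r _; apply: integral_ge0 => x _; exact: F0.
rewrite (fubini_tonelli (m1 := mu) (m2 := mu) _ mH H0).
rewrite muleA -EFinM -normfV -normrM fubini_tonelli1//.
rewrite -ge0_integralZl//; last 2 first.
  exact: (measurable_fun_fubini_tonelli_G (m1 := mu) _ mH H0).
  by move=> r _; apply: integral_ge0 => x _; exact: F0.
apply: eq_integral => x _.
rewrite /fubini_F (@ge0_integral_affine (det / e.1)
  (p.2 + (x - p.1) / e.1 * e.2))//; last 2 first.
- by rewrite mulf_neq0// invr_eq0.
- exact: (measurableT_comp mF (pair1_measurable x)).
congr (_ * _)%E; apply: eq_integral => r _; rewrite /H; congr (F (_, _)).
by rewrite addrC [r * _]mulrC.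
Qed.

(** When [e.1] vanishes [e'.1] does not, and exchanging the two vectors only
    changes the sign of the determinant. *)
Lemma ge0_integral_affine2 (p e e' : R * R) (F : R * R -> \bar R) :
  e.1 * e'.2 - e.2 * e'.1 != 0 ->
  measurable_fun setT F -> (forall x, 0 <= F x)%E ->
  (\int[mu2]_x F x = `|e.1 * e'.2 - e.2 * e'.1|%:E *
     \int[mu]_s \int[mu]_r F (p + s *: e + r *: e')%R)%E.
Proof.
move=> det0 mF F0; have [e10|e10] := eqVneq e.1 0; last first.
  exact: ge0_integral_affine2_neq0.
have e10' : e'.1 != 0.
  by apply: contra_neq det0 => e10'; rewrite e10 e10' mul0r mulr0 subrr.
have detN : e.1 * e'.2 - e.2 * e'.1 = - (e'.1 * e.2 - e'.2 * e.1) by ring.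
have det0' : e'.1 * e.2 - e'.2 * e.1 != 0 by rewrite -oppr_eq0 -detN.
rewrite (ge0_integral_affine2_neq0 p e10' det0' mF F0).
rewrite detN normrN (integral_affine2C p e e' mF F0); congr (_ * _)%E.
apply: eq_integral => s _; apply: eq_integral => r _; congr F.
by rewrite addrAC.
Qed.

Lemma measurable_integral_affine2 (p e e' : R * R) (I : set R)
    (g : R * R -> \bar R) : measurable I ->
  measurable_fun setT g -> (forall x, 0 <= g x)%E -> measurable_fun setT
    (fun s : R => \int[mu]_(r in I) g (p + s *: e + r *: e')%R)%E.
Proof.
move=> mI mg g0.
pose h (z : R * R) : \bar R :=
  if z.2 \in I then g (p + z.1 *: e + z.2 *: e') else 0%E.
rewrite (_ : (fun _ => _) = fubini_F mu h); last first.
  by apply/funext => s; rewrite integral_mkcond.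
apply: measurable_fun_fubini_tonelli_F; last first.
  by move=> z; rewrite /h; case: ifP.
have -> : h = (fun z : R * R => g (p + z.1 *: e + z.2 *: e')) \_ (setT `*` I).
  apply/funext => z; rewrite /h patchE; congr (if _ then _ else _).
  by rewrite in_setX in_setT.
have mTI : measurable ([set: R] `*` I) by exact: measurableX.
apply/(measurable_restrictT _ mTI); apply: measurable_funTS.
by apply: measurableT_comp mg _; exact: measurable_affine2.
Qed.

(** An inequality for any [D] containing the open parallelogram: this is what
    allows integrals over the region enclosed by a square to be bounded below
    without identifying that region. *)
Lemma ge0_integral_parallelogram (p e e' : R * R) (D : set (R * R))
    (f : R * R -> \bar R) :
  measurable D -> measurable_fun setT f -> (forall x, 0 <= f x)%E ->
  (forall s r, 0 < s < 1 -> 0 < r < 1 -> D (p + s *: e + r *: e')) ->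
  (`|e.1 * e'.2 - e.2 * e'.1|%:E *
     \int[mu]_(s in `]0%R, 1%R[) \int[mu]_(r in `]0%R, 1%R[)
       f (p + s *: e + r *: e')%R
   <= \int[mu2]_(x in D) f x)%E.
Proof.
move=> mD mf f0 QD.
have [->|det0] := eqVneq (e.1 * e'.2 - e.2 * e'.1) 0.
  by rewrite normr0 mul0e integral_ge0.
have fD0 x : (0 <= (f \_ D) x)%E by rewrite patchE; case: ifP.
have mfD : measurable_fun setT (f \_ D).
  by apply/(measurable_restrictT _ mD); exact: measurable_funTS.
rewrite [leRHS]integral_mkcond (@ge0_integral_affine2 p e e')//.
apply: lee_wpmul2l; first by rewrite lee_fin.
rewrite [leLHS]integral_mkcond; apply: ge0_le_integral => //.
- by move=> s _; rewrite patchE; case: ifP => // _; exact: integral_ge0.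
- apply/(measurable_restrictT _ (measurable_itv _)).
  by apply: measurable_funTS; exact: measurable_integral_affine2.
- exact: (@measurable_integral_affine2 _ _ _ setT).
move=> s _; rewrite patchE; case: ifPn => [|_]; last exact: integral_ge0.
rewrite inE/= in_itv/= => s01; rewrite [leLHS]integral_mkcond.
have mp (g : R * R -> \bar R) : measurable_fun setT g ->
    measurable_fun setT (fun r : R => g (p + s *: e + r *: e')).
  move=> mg; have mT := measurableT_comp mg (measurable_affine2 p e e').
  exact: (measurableT_comp mT (pair1_measurable s)).
apply: ge0_le_integral => //.
- by move=> r _; rewrite patchE; case: ifP.
- apply/(measurable_restrictT _ (measurable_itv _)).
  by apply: measurable_funTS; exact: mp.
- exact: mp.
move=> r _; rewrite !patchE; case: ifPn => [|_]; last exact: fD0.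
by rewrite inE/= in_itv/= => r01; rewrite mem_set//; exact: QD.
Qed.

Lemma parallelogram_area_le (p e e' : R * R) (D : set (R * R)) :
  measurable D ->
  (forall s r, 0 < s < 1 -> 0 < r < 1 -> D (p + s *: e + r *: e')) ->
  (`|e.1 * e'.2 - e.2 * e'.1|%:E <= mu2 D)%E.
Proof.
move=> mD QD.
have unit_itv : mu `]0%R, 1%R[%classic = 1%E.
  by rewrite lebesgue_measure_itv/= lte_fin ltr01 sube0.
have := @ge0_integral_parallelogram p e e' D (cst 1%E) mD (measurable_cst _)
  (fun=> lee01) QD.
rewrite [leRHS]integral_cst// mul1e; apply: le_trans.
rewrite -[leLHS]mule1; apply: lee_wpmul2l; first by rewrite lee_fin.
under eq_integral do rewrite integral_cst//= unit_itv mule1.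
by rewrite integral_cst//= unit_itv mule1.
Qed.

Lemma ball_area (x : R * R) (e : R) : 0 < e ->
  mu2 (ball x e) = (e *+ 2 * e *+ 2)%:E.
Proof.
move=> e0; rewrite (_ : ball x e = ball x.1 e `*` ball x.2 e)//.
rewrite product_measure1E//; do ?by rewrite ball_itv; exact: measurable_itv.
rewrite !ball_itv /= !lebesgue_measure_itv/= !lte_fin.
rewrite !ltrBlDr -!addrA !ltrDl !addr_gt0// -!EFinB -EFinM; congr EFin; ring.
Qed.

End PlaneMeasure.

(** * Directional derivatives and traces along a segment *)

Section DirectionalDerivative.
Context {R : realType}.
Local Open Scope classical_set_scope.
Local Notation mu := (@lebesgue_measure R).
Local Notation mu2 := (lebesgue2 R).

Lemma is_derive_line (f : R * R -> R) (p v : R * R) (s : R) :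
  derivable f (p + s *: v) v ->
  is_derive s (1 : R) (fun s : R => f (p + s *: v)) ('D_v f (p + s *: v)).
Proof.
have E : (fun h : R => h^-1 *: ((f \o shift (p + s *: v)) (h *: v)
    - f (p + s *: v))) =
    (fun h : R => h^-1 *: (((fun s : R => f (p + s *: v)) \o shift s) (h *: (1:R))
    - f (p + s *: v))).
  apply/funext => h /=; congr (_ *: (f _ - _)).
  by rewrite addrCA -scalerDl [h *: 1]mulr1.
move=> df; apply: DeriveDef; first by rewrite /derivable -E.
by rewrite /derive -E.
Qed.

Lemma is_derive_slice1 (f : R * R -> R) (y t : R) :
  derivable f (t, y) ((1, 0) : R * R) ->
  is_derive t (1 : R) (fun t => f (t, y)) (partial1 f (t, y)).
Proof.
move=> df; have := @is_derive_line f (0, y) (1, 0) t.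
have E (u : R) : ((0, y) + u *: (1, 0) : R * R) = (u, y).
  by congr pair; rewrite /= ?[u *: _]mulr1 ?[u *: _]mulr0 ?add0r ?addr0.
rewrite E => /(_ df); rewrite (_ : (fun s => _) = (fun t => f (t, y)))//.
by apply/funext => u; rewrite E.
Qed.

Lemma is_derive_slice2 (f : R * R -> R) (x t : R) :
  derivable f (x, t) ((0, 1) : R * R) ->
  is_derive t (1 : R) (fun t => f (x, t)) (partial2 f (x, t)).
Proof.
move=> df; have := @is_derive_line f (x, 0) (0, 1) t.
have E (u : R) : ((x, 0) + u *: (0, 1) : R * R) = (x, u).
  by congr pair; rewrite /= ?[u *: _]mulr1 ?[u *: _]mulr0 ?add0r ?addr0.
rewrite E => /(_ df); rewrite (_ : (fun s => _) = (fun t => f (x, t)))//.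
by apply/funext => u; rewrite E.
Qed.

Lemma mean_value (phi dphi : R -> R) (a b : R) :
  (forall x, is_derive x (1 : R) phi (dphi x)) ->
  exists2 c, `|c - a| <= `|b - a| & phi b - phi a = dphi c * (b - a).
Proof.
move=> dphiE.
have cphi x y : {within `[x, y], continuous phi}.
  apply: continuous_subspaceT => z; apply: differentiable_continuous.
  by apply/derivable1_diffP; have [] := dphiE z.
have [ab|ba] := leP a b.
  have [//|c /itvP cab ->] := MVT_segment ab (fun x _ => dphiE x).
  by exists c => //; rewrite !ger0_norm ?subr_ge0 ?lerD2r ?cab.
have [//|c /itvP cab E] := MVT_segment (ltW ba) (fun x _ => dphiE x).
exists c; last by rewrite -opprB E -mulrN opprB.
by rewrite !ler0_norm ?subr_le0 ?cab ?lerN2 ?lerD2r ?(ltW ba)// cab.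
Qed.

(** Going from [x] to [x + h *: v] one coordinate at a time, the mean value
    theorem turns each of the two increments into a partial derivative at a
    point near [x], and the partial derivatives are continuous. *)
Lemma C1_directional (f : R * R -> R) (x v : R * R) : Ck 1 f ->
  derivable f x v /\ 'D_v f x = v.1 * partial1 f x + v.2 * partial2 f x.
Proof.
move=> [_ d1 d2 /= c1 c2].
pose L := v.1 * partial1 f x + v.2 * partial2 f x.
suff H : (fun h : R => h^-1 *: ((f \o shift x) (h *: v) - f x)) @ 0^' --> L.
  by split; [apply/cvg_ex; exists L|exact/cvg_lim].
have slice1 y t : is_derive t (1 : R) (fun t => f (t, y)) (partial1 f (t, y)).
  exact: is_derive_slice1.
have slice2 z t : is_derive t (1 : R) (fun t => f (z, t)) (partial2 f (z, t)).
  exact: is_derive_slice2.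
apply/cvgrPdist_le => e e0.
pose e' := e / (`|v.1| + `|v.2| + 1).
have N0 : 0 < `|v.1| + `|v.2| + 1 by rewrite ltr_wpDl ?addr_ge0.
have e'0 : 0 < e' by rewrite divr_gt0.
have /cvgrPdist_le /(_ _ e'0) /nbhs_ballP[r1 /= r10 near1] := c1 x.
have /cvgrPdist_le /(_ _ e'0) /nbhs_ballP[r2 /= r20 near2] := c2 x.
pose r := Num.min r1 r2.
have r0 : 0 < r by rewrite lt_min r10.
near=> h.
have h0 : h != 0 by near: h; exact: nbhs_dnbhs_neq.
have hr : `|h| * (`|v.1| + `|v.2| + 1) < r.
  rewrite -ltr_pdivlMr//; near: h.
  apply: dnbhs0_lt; by rewrite divr_gt0.
have [c cv1 E1] := mean_value x.1 (x.1 + h * v.1) (slice1 (x.2 + h * v.2)).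
have [d dv2 E2] := mean_value x.2 (x.2 + h * v.2) (slice2 x.1).
have vE : (f \o shift x) (h *: v) = f (x.1 + h * v.1, x.2 + h * v.2).
  by rewrite /= addrC.
rewrite addrAC subrr add0r in E1 cv1; rewrite addrAC subrr add0r in E2 dv2.
rewrite normrM in cv1; rewrite normrM in dv2.
have hv1 : `|h| * `|v.1| < r.
  apply: le_lt_trans hr; rewrite ler_wpM2l// -addrA lerDl addr_ge0//.
have hv2 : `|h| * `|v.2| < r.
  apply: le_lt_trans hr; rewrite ler_wpM2l//.
  by rewrite addrAC lerDr addr_ge0.
have n1 : `|partial1 f x - partial1 f (c, x.2 + h * v.2)| <= e'.
  apply: near1; split; rewrite -ball_normE /ball_/= distrC.
    by apply: (le_lt_trans cv1); rewrite (lt_le_trans hv1)// ge_min lexx.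
  by rewrite /= addrAC subrr add0r normrM (lt_le_trans hv2)// ge_min lexx.
have n2 : `|partial2 f x - partial2 f (x.1, d)| <= e'.
  apply: near2; split; rewrite -ball_normE /ball_/= distrC.
    by rewrite subrr normr0.
  by apply: (le_lt_trans dv2); rewrite (lt_le_trans hv2)// ge_min lexx orbT.
have -> : h^-1 *: ((f \o shift x) (h *: v) - f x) =
    v.1 * partial1 f (c, x.2 + h * v.2) + v.2 * partial2 f (x.1, d).
  have -> : (f \o shift x) (h *: v) - f x =
      h * (v.1 * partial1 f (c, x.2 + h * v.2) + v.2 * partial2 f (x.1, d)).
    rewrite vE mulrDr !mulrA [h * _ * _]mulrC -E1 [h * _ * _]mulrC -E2.
    by rewrite addrA subrK -surjective_pairing.
  by rewrite [LHS]mulrA mulVf// mul1r.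
have -> : L - (v.1 * partial1 f (c, x.2 + h * v.2) + v.2 * partial2 f (x.1, d)) =
    v.1 * (partial1 f x - partial1 f (c, x.2 + h * v.2)) +
    v.2 * (partial2 f x - partial2 f (x.1, d)) by rewrite /L; ring.
rewrite (le_trans (ler_normD _ _))// !normrM.
have -> : e = `|v.1| * e' + `|v.2| * e' + e'.
  by rewrite /e'; field; rewrite gt_eqF.
by rewrite ler_wpDr ?(ltW e'0)// lerD// ler_wpM2l.
Unshelve. all: by end_near. Qed.

Lemma continuous_line (g : R * R -> R) (p v : R * R) :
  continuous g -> continuous (fun r : R => g (p + r *: v)).
Proof.
move=> cg r; apply: continuous_comp; last exact: cg.
apply: cvgD; first exact: cvg_cst.
exact: scalel_continuous.
Qed.

Lemma continuous_sqr (T : topologicalType) (g : T -> R) :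
  continuous g -> continuous (fun x => g x ^+ 2).
Proof.
move=> cg x; exact: (@continuous_comp _ _ _ g (fun y => y ^+ 2) x (cg x)
  (@exprn_continuous R 2 _)).
Qed.

(** The integrand of the trace inequality.  The parameter [eta] trades the
    gradient against the function, and [k] is the squared length of the segments
    along which boundary values are propagated inwards. *)
Definition energy_density (w : R * R -> R) (eta k : R) (x : R * R) : R :=
  (1 + eta^-1) * w x ^+ 2 +
  eta * k * (partial1 w x ^+ 2 + partial2 w x ^+ 2).

Lemma continuous_energy_density (w : R * R -> R) (eta k : R) : Ck 1 w ->
  continuous (energy_density w eta k).
Proof.
move=> [cw _ _ /= c1 c2] x; rewrite /energy_density.
apply: cvgD; apply: (cvgM (cvg_cst _)); first exact: (continuous_sqr cw).
by apply: cvgD; [exact: (continuous_sqr c1)|exact: (continuous_sqr c2)].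
Qed.

Lemma energy_density_ge0 (w : R * R -> R) (eta k : R) (x : R * R) :
  0 <= eta -> 0 <= k -> 0 <= energy_density w eta k x.
Proof.
move=> eta0 k0; rewrite /energy_density addr_ge0// mulr_ge0 ?addr_ge0 ?invr_ge0//.
- by rewrite sqr_ge0.
- by rewrite mulr_ge0.
- by rewrite sqr_ge0.
- by rewrite sqr_ge0.
Qed.

(** With [W r = w (p + r *: v)], the function [(r - 1) * W r ^+ 2] vanishes at
    [r = 1] and equals [- w p ^+ 2] at [r = 0], so [w p ^+ 2] is the integral of
    its derivative [W ^+ 2 + (r - 1) * 2 W W'].  The arithmetic-geometric
    inequality bounds the second term by [eta^-1 * W ^+ 2 + eta * W' ^+ 2]. *)
Lemma trace_on_segment (w : R * R -> R) (p v : R * R) (eta : R) :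
  Ck 1 w -> 0 < eta ->
  ((w p ^+ 2)%:E <= \int[mu]_(r in `]0%R, 1%R[)
     (energy_density w eta (dot v v) (p + r *: v))%:E)%E.
Proof.
move=> C1w eta0; have [cw _ _ /= c1 c2] := C1w.
pose W r := w (p + r *: v).
pose dW r := v.1 * partial1 w (p + r *: v) + v.2 * partial2 w (p + r *: v).
have W' r : is_derive r (1 : R) W (dW r).
  rewrite /dW; have [d <-] := C1_directional (p + r *: v) v C1w.
  exact: is_derive_line.
pose F r := (r - 1) * W r ^+ 2.
pose f r := W r ^+ 2 + (r - 1) * (W r * dW r *+ 2).
have F' r : is_derive r (1 : R) F (f r).
  have := W' r => W'r.
  have -> : F = (id - cst 1) * (W ^+ 2).
    by apply/funext => x; rewrite /F /= exprfctE.
  apply: is_derive_eq.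
  rewrite /f /= exprfctE /cst /GRing.scale /= expr1.
  rewrite (_ : (id - (fun=> 1)) r = r - 1)//; ring.
have cW : continuous W by exact: continuous_line.
have cdW : continuous dW.
  move=> r; apply: cvgD; apply: (cvgM (cvg_cst _)).
    exact: (continuous_line c1).
  exact: (continuous_line c2).
have cf : continuous f.
  move=> r; apply: cvgD.
    exact: continuous_sqr.
  apply: cvgM; first by apply: cvgB; [exact: cvg_id|exact: cvg_cst].
  by apply: cvgMn; apply: cvgM; [exact: cW|exact: cdW].
have cG : continuous (fun r : R => energy_density w eta (dot v v) (p + r *: v)).
  by apply: continuous_line; exact: continuous_energy_density.
have ftc : (\int[mu]_(r in `[0%R, 1%R]) (f r)%:E = (w p ^+ 2)%:E)%E.
  rewrite (@continuous_FTC2 _ f F)//.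
  - rewrite -EFinB /F /W subrr mul0r sub0r scale0r addr0; congr EFin; ring.
  - exact: continuous_subspaceT.
  - have cF : continuous F.
      move=> r; apply: differentiable_continuous.
      by apply/derivable1_diffP; have [] := F' r.
    split.
    + by move=> x _; have [] := F' x.
    + by apply: cvg_at_right_filter; exact: cF.
    + by apply: cvg_at_left_filter; exact: cF.
  - by move=> x _; rewrite derive1E; have [_ ->] := F' x.
have mG : measurable_fun setT
    (fun r : R => (energy_density w eta (dot v v) (p + r *: v))%:E).
  by apply/measurable_EFinP; exact: continuous_measurable_fun.
rewrite -ftc -(@integral_itv_bndoo _ 0 1 _ true false); last first.
  exact: measurable_funTS.
apply: le_integral => //.
- apply: continuous_compact_integrable; first exact: segment_compact.
  exact: continuous_subspaceT.
- apply: continuous_compact_integrable; first exact: segment_compact.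
  exact: continuous_subspaceT.
move=> r; rewrite inE/= in_itv/= => /andP[r0 r1]; rewrite lee_fin.
rewrite /f /energy_density /dot -/(W r) /dW.
move: (W r) (partial1 w _) (partial2 w _) => a b c.
pose d := v.1 * b + v.2 * c; rewrite -/d.
have dle : d ^+ 2 <= (v.1 * v.1 + v.2 * v.2) * (b ^+ 2 + c ^+ 2).
  rewrite -subr_ge0 (_ : _ - _ = (v.1 * c - v.2 * b) ^+ 2) ?sqr_ge0//.
  by rewrite /d; ring.
have amgm : (r - 1) * (a * d *+ 2) <= eta^-1 * a ^+ 2 + eta * d ^+ 2.
  have h1 : 0 <= eta^-1 * (a + (1 - r) * eta * d) ^+ 2.
    by rewrite mulr_ge0 ?sqr_ge0 ?invr_ge0 ?(ltW eta0).
  have h2 : eta^-1 * (a + (1 - r) * eta * d) ^+ 2 =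
      eta^-1 * a ^+ 2 - (r - 1) * (a * d *+ 2) + eta * d ^+ 2 * (1 - r) ^+ 2.
    by field; rewrite gt_eqF.
  have h3 : eta * d ^+ 2 * (1 - r) ^+ 2 <= eta * d ^+ 2.
    apply: ler_piMr; first by rewrite mulr_ge0 ?sqr_ge0 ?(ltW eta0).
    by apply: exprn_ile1; [rewrite subr_ge0|lra].
  lra.
have h4 := ler_wpM2l (ltW eta0) dle.
rewrite [(1 + _) * _]mulrDl mul1r -addrA lerD2l -(mulrA eta).
by apply: (le_trans amgm); rewrite lerD2l.
Qed.

(** Integrating [trace_on_segment] over the starting point on the side
    [p + s *: e] gives an integral over a parallelogram. *)
Lemma trace_on_side (w : R * R -> R) (p e e' : R * R) (D : set (R * R))
    (eta : R) :
  measurable D ->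
  (forall s r, 0 < s < 1 -> 0 < r < 1 -> D (p + s *: e + r *: e')) ->
  Ck 1 w -> 0 < eta ->
  (`|e.1 * e'.2 - e.2 * e'.1|%:E *
     \int[mu]_(s in `[0%R, 1%R]) (w (p + s *: e) ^+ 2)%:E
   <= \int[mu2]_(x in D) (energy_density w eta (dot e' e') x)%:E)%E.
Proof.
move=> mD QD C1w eta0; have [cw _ _ _ _] := C1w.
have k0 : 0 <= dot e' e' by rewrite addr_ge0// -expr2 sqr_ge0.
have mG : measurable_fun setT
    (fun x => (energy_density w eta (dot e' e') x)%:E).
  apply/measurable_EFinP; apply: continuous_measurable2.
  exact: continuous_energy_density.
have G0 x : (0 <= (energy_density w eta (dot e' e') x)%:E)%E.
  by rewrite lee_fin energy_density_ge0// ltW.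
have mw : measurable_fun setT (fun s : R => (w (p + s *: e) ^+ 2)%:E).
  apply/measurable_EFinP; apply: continuous_measurable_fun.
  by apply: continuous_sqr; exact: continuous_line.
apply: le_trans (ge0_integral_parallelogram mD mG G0 QD).
apply: lee_wpmul2l; first by rewrite lee_fin.
rewrite integral_itv_bndoo; last exact: measurable_funTS.
apply: ge0_le_integral => //.
- by move=> s _; rewrite lee_fin sqr_ge0.
- exact: measurable_funTS.
- apply: measurable_funTS.
  exact: (@measurable_integral_affine2 _ p e e' _ _ (measurable_itv _) mG G0).
- by move=> s _; exact: trace_on_segment.
Qed.

End DirectionalDerivative.

(** * Constants have zero weak gradient *)

Section TestFunctions.
Context {R : realType}.
Local Open Scope classical_set_scope.
Local Notation mu := (@lebesgue_measure R).
Local Notation mu2 := (lebesgue2 R).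

Lemma integral_derivative_eq0 (psi dpsi : R -> R) (N : R) : 0 < N ->
  (forall x, is_derive x (1 : R) psi (dpsi x)) -> continuous dpsi ->
  (forall x, N <= `|x| -> psi x = 0 /\ dpsi x = 0) ->
  (\int[mu]_x (dpsi x)%:E = 0)%E.
Proof.
move=> N0 psi' cdpsi out.
have -> : (\int[mu]_x (dpsi x)%:E = \int[mu]_(x in `[(- N)%R, N]) (dpsi x)%:E)%E.
  rewrite [RHS]integral_mkcond; apply: eq_integral => x _; rewrite patchE.
  case: ifPn => //; rewrite notin_setE/= in_itv/= => /negP xN.
  have [|_ ->//] := out x.
  by move: xN; rewrite -ler_norml -ltNge => /ltW.
have cpsi : continuous psi.
  move=> r; apply: differentiable_continuous.
  by apply/derivable1_diffP; have [] := psi' r.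
rewrite (@continuous_FTC2 _ dpsi psi); first last.
- by move=> x _; rewrite derive1E; have [_ ->] := psi' x.
- split.
  + by move=> x _; have [] := psi' x.
  + by apply: cvg_at_right_filter; exact: cpsi.
  + by apply: cvg_at_left_filter; exact: cpsi.
- exact: continuous_subspaceT.
- by rewrite gtrN.
have [|-> _] := out N; first by rewrite ger0_norm// ltW.
have [|-> _] := out (- N); first by rewrite normrN ger0_norm// ltW.
by rewrite sube0.
Qed.

Lemma compact_support_integrable (f : R * R -> R) (K : set (R * R)) :
  compact K -> continuous f -> (forall x, ~ K x -> f x = 0) ->
  mu2.-integrable setT (EFin \o f).
Proof.
move=> cK cf out.
have mK : measurable K.
  rewrite -[K]setCK; apply: measurableC; apply: open_measurable2.
  by apply: closed_openC; apply: compact_closed => //; exact: norm_hausdorff.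
have -> : EFin \o f = (EFin \o f) \_ K.
  apply/funext => x; rewrite patchE; case: ifPn => //=.
  by rewrite notin_setE => /out ->.
apply/(@integrable_mkcond _ _ R mu2 K (EFin \o f) mK).
have /compact_bounded[M [_ KM]] := cK.
have [N [N0 KN]] : exists N, 0 < N /\ K `<=` ball 0 N.
  exists (`|M| + 2); split; first by rewrite ltr_wpDl.
  move=> x /(KM (`|M| + 1)) /= Kx.
  rewrite -ball_normE /ball_/= sub0r normrN; apply: le_lt_trans (Kx _) _.
    by rewrite (le_lt_trans (ler_norm M))// ltrDl.
  by rewrite ltrD2l ltr1n.
apply: measurable_bounded_integrable => //.
- apply: (@le_lt_trans _ _ (mu2 (ball 0 N))); last by rewrite ball_area// ltry.
  by apply: le_measure; rewrite ?inE//; exact: measurable_ball2.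
- by apply: measurable_funTS; exact: continuous_measurable2.
have /compact_bounded[B [Br KB]] : compact (f @` K).
  by apply: continuous_compact => //; exact: continuous_subspaceT.
exists B; split => // B' BB' x Kx; exact: KB.
Qed.

Lemma partial_out_support (phi : R * R -> R) (v x : R * R) :
  ~ closure [set x | phi x != 0] x -> 'D_v phi x = 0.
Proof.
move=> xS; rewrite (@near_eq_derive _ _ _ _ (cst 0)) ?derive_cst//.
have : nbhs x (~` closure [set x | phi x != 0]).
  by apply: open_nbhs_nbhs; split => //; exact/closed_openC/closed_closure.
apply: filterS => y; apply: contra_notP => /eqP yS; exact: subset_closure.
Qed.

(** Fubini reduces the claim to the slices parallel to an axis, on which the
    fundamental theorem of calculus yields a difference of two values taken
    outside the support. *)
Lemma test_function_partial_integral (D : set (R * R)) (phi : R * R -> R) :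
  test_function D phi ->
  (\int[mu2]_(x in D) (partial1 phi x)%:E = 0 /\
   \int[mu2]_(x in D) (partial2 phi x)%:E = 0)%E.
Proof.
move=> [/(_ 1%N)[cphi d1 d2 /= c1 c2] cK KD].
set K := closure _ in cK KD.
have out v x : ~ K x -> 'D_v phi x = 0 by exact: partial_out_support.
have phi0 x : ~ K x -> phi x = 0.
  by apply: contra_notP => /eqP x0; rewrite /K; exact: subset_closure.
have intD v : (\int[mu2]_(x in D) ('D_v phi x)%:E = \int[mu2]_x ('D_v phi x)%:E)%E.
  rewrite integral_mkcond; apply: eq_integral => x _; rewrite patchE.
  by case: ifPn => //; rewrite notin_setE => xD; rewrite out// => /KD.
have /compact_bounded[M [_ KM]] := cK.
pose N := `|M| + 2.
have N0 : 0 < N by rewrite ltr_wpDl.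
have KN x : N <= `|x| -> ~ K x.
  move=> Nx /(KM (`|M| + 1)) /= Kx.
  have /Kx xM : M < `|M| + 1 by rewrite (le_lt_trans (ler_norm M))// ltrDl.
  by move: (le_trans Nx xM); rewrite lerD2l lern1.
split.
- rewrite intD.
  have i1 : mu2.-integrable setT (EFin \o partial1 phi).
    by apply: (compact_support_integrable cK c1) => x; exact: out.
  rewrite -(integral21_prod_meas1 i1)/=.
  rewrite (_ : (fun _ => _) = cst 0%E) ?integral0//; apply/funext => y.
  apply: (@integral_derivative_eq0 (fun x => phi (x, y)) _ N) => //.
  + by move=> x; exact: is_derive_slice1.
  + move=> x; apply: (@continuous_comp _ _ _ (fun x : R => (x, y)) (partial1 phi) x).
      exact: (@cvg_pair _ _ _ (nbhs x) (nbhs x) (nbhs y) _ _ _ id (cst y)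
        cvg_id (cvg_cst y)).
    exact: c1.
  + move=> x Nx; suff xK : ~ K (x, y) by split; [exact: phi0|exact: out].
    by apply: KN; rewrite prod_normE/= le_max Nx.
- rewrite intD.
  have i1 : mu2.-integrable setT (EFin \o partial2 phi).
    by apply: (compact_support_integrable cK c2) => x; exact: out.
  rewrite -(integral12_prod_meas1 i1)/=.
  rewrite (_ : (fun _ => _) = cst 0%E) ?integral0//; apply/funext => x.
  apply: (@integral_derivative_eq0 (fun y => phi (x, y)) _ N) => //.
  + by move=> y; exact: is_derive_slice2.
  + move=> y; apply: (@continuous_comp _ _ _ (fun y : R => (x, y)) (partial2 phi) y).
      exact: (@cvg_pair _ _ _ (nbhs y) (nbhs x) (nbhs y) _ _ _ (cst x) id
        (cvg_cst x) cvg_id).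
    exact: c2.
  + move=> y Ny; suff xK : ~ K (x, y) by split; [exact: phi0|exact: out].
    by apply: KN; rewrite prod_normE/= le_max Ny orbT.
Qed.

Lemma weak_gradient_one (D : set (R * R)) :
  weak_gradient D (cst 1) (cst (0, 0)).
Proof.
move=> phi /test_function_partial_integral[I1 I2].
have z (g : R * R -> R) : (- (\int[mu2]_(x in D) (0 * g x)%:E) = 0)%E.
  by rewrite integral0_eq ?oppe0// => x _; rewrite mul0r.
split; rewrite z.
- by rewrite -[RHS]I1; apply: eq_integral => x _; rewrite mul1r.
- by rewrite -[RHS]I2; apply: eq_integral => x _; rewrite mul1r.
Qed.

End TestFunctions.

(** * The interior region of a polygon *)

Section Region.
Context {R : realType}.
Local Open Scope classical_set_scope.

Lemma continuous_segment (p v : R * R) : continuous (fun t : R => p + t *: v).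
Proof. by move=> t; apply: cvgD; [exact: cvg_cst|exact: scalel_continuous]. Qed.

Lemma segment_component (U : set (R * R)) (x d : R * R) (T : R) : 0 <= T ->
  (forall t, 0 <= t <= T -> U (x + t *: d)) ->
  connected_component U x (x + T *: d).
Proof.
move=> T0 inU; exists ((fun t : R => x + t *: d) @` `[0, T]); last first.
  by exists T => //=; rewrite in_itv/= T0 lexx.
split.
- by exists 0; rewrite ?scale0r ?addr0//= in_itv/= lexx.
- by move=> _ [t /= tT <-]; apply: inU; move: tT; rewrite in_itv.
apply: connected_continuous_connected; first exact: segment_connected.
by apply: continuous_subspaceT; exact: continuous_segment.
Qed.

Lemma poly_boundary_closed n (v : 'I_n -> R * R) : closed (poly_boundary v).
Proof.
rewrite /poly_boundary; apply: closed_bigcup => [|i _].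
  exact: finite_finset.
apply: compact_closed; first exact: norm_hausdorff.
apply: continuous_compact; last exact: segment_compact.
by apply: continuous_subspaceT; exact: continuous_segment.
Qed.

(** A ball is star-shaped about its centre, so it stays in the component of the
    centre. *)
Lemma open_component (U : set (R * R)) (x : R * R) :
  open U -> open (connected_component U x).
Proof.
move=> oU; rewrite openE => y xy.
have Uy : U y by exact: connected_component_sub xy.
have /nbhs_ballP[e /= e0 eU] : nbhs y U by exact: open_nbhs_nbhs.
apply/nbhs_ballP; exists e => //= z yz; apply: connected_component_trans xy _.
have -> : z = y + 1 *: (z - y) by rewrite scale1r addrC subrK.
apply: segment_component => // t /andP[t0 t1]; apply: eU.
move: yz; rewrite -ball_normE /ball_/= opprD addrA subrr add0r normrN normrZ.
rewrite distrC ger0_norm//; apply: le_lt_trans.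
by rewrite ler_piMl.
Qed.

Lemma poly_region_open n (v : 'I_n -> R * R) : open (poly_region v).
Proof.
have oU : open (~` poly_boundary v) by exact/closed_openC/poly_boundary_closed.
rewrite openE => x [Ux bx].
have : nbhs x (connected_component (~` poly_boundary v) x).
  by apply: open_nbhs_nbhs; split; [exact: open_component|
    exact: connected_component_refl].
apply: filterS => y xy; split; first exact: connected_component_sub xy.
by rewrite -(same_connected_component xy).
Qed.

Lemma poly_region_measurable n (v : 'I_n -> R * R) : measurable (poly_region v).
Proof. apply: open_measurable2; exact: poly_region_open. Qed.

Lemma ray_unbounded (U : set (R * R)) (x d : R * R) : d != 0 ->
  (forall t, 0 <= t -> U (x + t *: d)) ->
  ~ bounded_set (connected_component U x).
Proof.
move=> d0 rayU [M [_ bM]].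
pose B := `|M| + 1.
have MB : M < B by rewrite (le_lt_trans (ler_norm M))// ltrDl.
have B0 : 0 < B by rewrite ltr_wpDl.
have nd : 0 < `|d| by rewrite normr_gt0.
pose T := (B + `|x| + 1) / `|d|.
have T0 : 0 <= T by rewrite divr_ge0// !addr_ge0// ltW.
have xT : connected_component U x (x + T *: d).
  by apply: segment_component => // t /andP[t0 _]; exact: rayU.
have /= bxT := bM B MB _ xT.
have Td : `|T *: d| = B + `|x| + 1.
  by rewrite normrZ ger0_norm// /T divfK// gt_eqF.
have : `|T *: d| <= `|x + T *: d| + `|x|.
  by rewrite -[X in `|X|](addrK x) [T *: d + x]addrC ler_normB.
by rewrite Td; lra.
Qed.

Lemma norm_le_enorm (p : R * R) : `|p| <= enorm p.
Proof.
rewrite prod_normE ge_max /enorm /dot -!expr2; apply/andP; split.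
  by rewrite -sqrtr_sqr ler_wsqrtr// lerDl sqr_ge0.
by rewrite -sqrtr_sqr ler_wsqrtr// lerDr sqr_ge0.
Qed.

Lemma enorm_le_norm (p : R * R) : enorm p <= 2 * `|p|.
Proof.
have p1 : p.1 ^+ 2 <= `|p| ^+ 2.
  by rewrite -[p.1 ^+ 2]real_normK ?num_real// lerXn2r ?nnegrE//
    prod_normE le_max lexx.
have p2 : p.2 ^+ 2 <= `|p| ^+ 2.
  by rewrite -[p.2 ^+ 2]real_normK ?num_real// lerXn2r ?nnegrE//
    prod_normE le_max lexx orbT.
rewrite -[leRHS]ger0_norm ?mulr_ge0// -sqrtr_sqr /enorm /dot ler_wsqrtr//.
rewrite exprMn; have := sqr_ge0 `|p|; nra.
Qed.

Lemma enorm_ge0 (p : R * R) : 0 <= enorm p.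
Proof. exact: sqrtr_ge0. Qed.

Definition perimeter n (v : 'I_n -> R * R) : R := \sum_(i < n) enorm (side v i).

Lemma vertex_dist n (v : 'I_n.+1 -> R * R) k (kn : (k < n.+1)%N) :
  `|v (Ordinal kn) - v ord0| <= \sum_(i < n.+1 | (i < k)%N) enorm (side v i).
Proof.
elim: k kn => [|k IH] kn.
  rewrite (_ : Ordinal kn = ord0); last exact: val_inj.
  by rewrite subrr normr0 sumr_ge0// => i _; exact: enorm_ge0.
pose ik := Ordinal (ltnW kn).
have -> : Ordinal kn = ordS ik by apply: val_inj; rewrite /= modn_small.
rewrite (bigD1 ik)//= (eq_bigl (fun i : 'I_n.+1 => (i < k)%N)); last first.
  by move=> i; rewrite -val_eqE/= ltnS ltn_neqAle andbC.
rewrite (_ : _ - _ = side v ik + (v ik - v ord0)); last by rewrite addrA subrK.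
by apply: le_trans (ler_normD _ _) _; apply: lerD; [exact: norm_le_enorm|exact: IH].
Qed.

Lemma poly_boundary_dist n (v : 'I_n.+1 -> R * R) x :
  poly_boundary v x -> `|x - v ord0| <= perimeter v.
Proof.
move=> [j _ [s /= s01 <-]]; rewrite /side_pt.
move: s01; rewrite in_itv/= => /andP[s0 s1].
rewrite addrAC (le_trans (ler_normD _ _))//.
case: j => j jn; have := vertex_dist v jn.
set J := Ordinal jn => vj.
apply: (@le_trans _ _ (\sum_(i < n.+1 | (i < j)%N) enorm (side v i)
                       + enorm (side v J))).
  rewrite lerD// normrZ ger0_norm// (le_trans _ (norm_le_enorm _))//.
  by rewrite ler_piMl.
rewrite /perimeter [leRHS](bigD1 J)//= [leLHS]addrC lerD2l.
rewrite [leRHS](bigID (fun i : 'I_n.+1 => (i < j)%N))/= -[leLHS]addr0 lerD//.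
  rewrite le_eqVlt; apply/orP; left; apply/eqP; apply: eq_bigl => i.
  by rewrite -val_eqE/=; case: ltngtP.
by apply: sumr_ge0 => i _; exact: enorm_ge0.
Qed.

(** From a point farther from the vertex than the perimeter, the ray
    pointing away from the vertex keeps farther than that, so it never meets
    the boundary and its component is unbounded. *)
Lemma poly_region_dist n (v : 'I_n.+1 -> R * R) x :
  poly_region v x -> `|x - v ord0| <= perimeter v.
Proof.
move=> [xB bx]; rewrite leNgt; apply/negP => Px; move: bx.
have P0 : 0 <= perimeter v by apply: sumr_ge0 => i _; exact: enorm_ge0.
apply: (@ray_unbounded _ x (x - v ord0)).
  by rewrite -normr_gt0; exact: le_lt_trans Px.
move=> t t0 /poly_boundary_dist; apply/negP; rewrite -ltNge.
rewrite (_ : _ - _ = (1 + t) *: (x - v ord0)); last first.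
  by rewrite scalerDl scale1r addrAC.
rewrite normrZ ger0_norm ?addr_ge0//; apply: (lt_le_trans Px).
by rewrite ler_peMl// lerDl.
Qed.

End Region.

(** * Squares *)

Section Square.
Context {R : realType}.
Local Open Scope classical_set_scope.

Lemma ordS4K (i : 'I_4) : ordS (ordS (ordS (ordS i))) = i.
Proof. by case: i => [[|[|[|[|//]]]] H]; exact: val_inj. Qed.

Lemma ord4P (i j : 'I_4) :
  [\/ j = i, j = ordS i, j = ordS (ordS i) | j = ordS (ordS (ordS i))].
Proof.
have /or4P : [|| j == i, j == ordS i, j == ordS (ordS i) |
    j == ordS (ordS (ordS i))].
  by case: i => [[|[|[|[|//]]]] iH]; case: j => [[|[|[|[|//]]]] jH].
by case=> /eqP ->; [constructor 1|constructor 2|constructor 3|constructor 4].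
Qed.

Lemma dotC (p q : R * R) : dot p q = dot q p.
Proof. by rewrite /dot [p.1 * _]mulrC [p.2 * _]mulrC. Qed.

Lemma dotDl (p q r : R * R) : dot (p + q) r = dot p r + dot q r.
Proof. by rewrite /dot /=; ring. Qed.

Lemma dotZl (k : R) (p q : R * R) : dot (k *: p) q = k * dot p q.
Proof. by rewrite /dot mulrDr !mulrA. Qed.

Lemma dot_eq0 (p : R * R) : (dot p p == 0) = (p == 0).
Proof.
apply/eqP/eqP => [|->]; last by rewrite /dot mulr0 addr0.
rewrite /dot -!expr2 => /eqP; rewrite paddr_eq0 ?sqr_ge0// !sqrf_eq0.
by move=> /andP[/eqP p1 /eqP p2]; rewrite [p]surjective_pairing p1 p2.
Qed.

Lemma enorm_sqr (p : R * R) : enorm p ^+ 2 = dot p p.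
Proof. by rewrite sqr_sqrtr// addr_ge0// -expr2 sqr_ge0. Qed.

(** Pairing the sum with [e0] gives [dot e2 e0 = - k], hence [e0 + e2] has
    squared length [k - 2 * k + k = 0]. *)
Lemma closed_orthogonal_cycle (e0 e1 e2 e3 : R * R) (k : R) :
  e0 + e2 + (e1 + e3) = 0 -> dot e0 e1 = 0 -> dot e3 e0 = 0 ->
  dot e0 e0 = k -> dot e2 e2 = k -> e2 = - e0 /\ e3 = - e1.
Proof.
move=> s0 d01 d30 d0 d2.
have d20 : dot e2 e0 = - k.
  move: (congr1 (fun z => dot z e0) s0).
  rewrite !dotDl d0 d30 (dotC e1) d01 /dot !mul0r; lra.
have e2E : e2 = - e0.
  apply/eqP; rewrite -addr_eq0 -dot_eq0 dotDl !(dotC _ (_ + _)) !dotDl.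
  by rewrite (dotC e0 e2) d20 d2 d0; apply/eqP; ring.
by split=> //; apply/eqP; rewrite -addr_eq0 addrC -s0 e2E subrr add0r.
Qed.

(** What a square looks like from its corner [v i]: all vertices and sides in
    terms of the two sides [side v i] and [side v (ordS i)]. *)
Variant square_frame (v : 'I_4 -> R * R) (i : 'I_4) (a : R) : Prop :=
  SquareFrame of 0 < a & dot (side v i) (side v i) = a ^+ 2 &
    dot (side v (ordS i)) (side v (ordS i)) = a ^+ 2 &
    dot (side v i) (side v (ordS i)) = 0 &
    v (ordS i) = v i + side v i &
    v (ordS (ordS i)) = v i + side v i + side v (ordS i) &
    v (ordS (ordS (ordS i))) = v i + side v (ordS i) &
    side v (ordS (ordS i)) = - side v i &
    side v (ordS (ordS (ordS i))) = - side v (ordS i).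

Lemma is_square_frame (v : 'I_4 -> R * R) (i : 'I_4) : is_square v ->
  square_frame v i (enorm (side v ord0)).
Proof.
move=> [[injv _ _] sideE ortho]; set a := enorm _.
have dE j : dot (side v j) (side v j) = a ^+ 2 by rewrite -enorm_sqr (sideE _ ord0).
have a0 : 0 < a.
  rewrite lt_neqAle enorm_ge0 andbT eq_sym -sqrf_eq0 enorm_sqr dot_eq0.
  by rewrite subr_eq0; apply/eqP => /injv/(congr1 val).
have v1 : v (ordS i) = v i + side v i by rewrite addrC subrK.
have v2 : v (ordS (ordS i)) = v i + side v i + side v (ordS i).
  by rewrite -v1 addrC subrK.
have s0 : side v i + side v (ordS (ordS i)) +
    (side v (ordS i) + side v (ordS (ordS (ordS i)))) = 0.
  by rewrite /side ordS4K; apply/pair_equal_spec; split => /=; ring.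
have o4 := ortho (ordS (ordS (ordS i))); rewrite ordS4K in o4.
have [s2 s3] := closed_orthogonal_cycle s0 (ortho i) o4 (dE i) (dE _).
split => //.
by rewrite -[LHS](subrK (v i)) -opprB -{1}(ordS4K i) -/(side v _) s3 opprK addrC.
Qed.

Lemma pair_ext (y z : R * R) : y.1 = z.1 -> y.2 = z.2 -> y = z.
Proof. by case: y z => [y1 y2] [z1 z2] /= -> ->. Qed.

(** In the plane such a vector is a quarter turn of [e], in one of the two
    directions; the sign [c] is the orientation. *)
Lemma orthogonal_same_norm (e e' : R * R) (a : R) : 0 < a ->
  dot e e = a ^+ 2 -> dot e' e' = a ^+ 2 -> dot e e' = 0 ->
  exists2 c : R, c ^+ 2 = 1 & e' = (- c * e.2, c * e.1).
Proof.
rewrite /dot => a0 de de' dee'; exists ((e.1 * e'.2 - e.2 * e'.1) / a ^+ 2).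
  rewrite expr_div_n (_ : (e.1 * e'.2 - e.2 * e'.1) ^+ 2 = (a ^+ 2) ^+ 2).
    by rewrite divff// !expf_neq0// gt_eqF.
  transitivity ((e.1 * e.1 + e.2 * e.2) * (e'.1 * e'.1 + e'.2 * e'.2) -
    (e.1 * e'.1 + e.2 * e'.2) ^+ 2); first by ring.
  by rewrite de de' dee' expr2; ring.
have a2 : a ^+ 2 != 0 by rewrite expf_neq0// gt_eqF.
rewrite [LHS]surjective_pairing; congr pair; apply: (mulIf a2).
  rewrite mulNr mulNr mulrAC divfK// -[in LHS]de.
  transitivity (e.1 * (e.1 * e'.1 + e.2 * e'.2) - (e.1 * e'.2 - e.2 * e'.1) * e.2).
    by ring.
  by rewrite dee' mulr0 sub0r.
rewrite mulrAC divfK// -[in LHS]de.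
transitivity (e.2 * (e.1 * e'.1 + e.2 * e'.2) + (e.1 * e'.2 - e.2 * e'.1) * e.1).
  by ring.
by rewrite dee' mulr0 add0r.
Qed.

Lemma orthogonal_det (e e' : R * R) (a : R) :  0 < a ->
  dot e e = a ^+ 2 -> dot e' e' = a ^+ 2 -> dot e e' = 0 ->
  `|e.1 * e'.2 - e.2 * e'.1| = a ^+ 2.
Proof.
move=> a0 de de' dee'; have [c c2 ->] := orthogonal_same_norm a0 de de' dee'.
rewrite /= (_ : _ - _ = c * dot e e); last by rewrite /dot; ring.
rewrite normrM de (ger0_norm (sqr_ge0 a)).
have /eqP := c2; rewrite sqrf_eq1 => /orP[] /eqP ->.
  by rewrite normr1 mul1r.
by rewrite normrN1 mul1r.
Qed.

Lemma orthogonal_decomposition (e e' x : R * R) (a : R) : 0 < a ->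
  dot e e = a ^+ 2 -> dot e' e' = a ^+ 2 -> dot e e' = 0 ->
  x = (dot x e / a ^+ 2) *: e + (dot x e' / a ^+ 2) *: e'.
Proof.
move=> a0 de de' dee'; have [c c2 e'E] := orthogonal_same_norm a0 de de' dee'.
have a2 : a ^+ 2 != 0 by rewrite expf_neq0// gt_eqF.
apply: pair_ext; apply: (mulIf a2); rewrite -[in LHS]de e'E /dot /=.
  transitivity ((x.1 * e.1 + x.2 * e.2) * e.1 +
    c ^+ 2 * (- x.1 * e.2 + x.2 * e.1) * (- e.2)).
    by rewrite c2; ring.
  by rewrite /GRing.scale /=; field; rewrite gt_eqF.
transitivity ((x.1 * e.1 + x.2 * e.2) * e.2 +
    c ^+ 2 * (- x.1 * e.2 + x.2 * e.1) * e.1).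
  by rewrite c2; ring.
by rewrite /GRing.scale /=; field; rewrite gt_eqF.
Qed.

Lemma continuous_dot (q e : R * R) : continuous (fun x : R * R => dot (x - q) e).
Proof.
move=> x; rewrite /dot; apply: cvgD; apply: cvgM; try exact: cvg_cst.
  apply: (@continuous_comp _ _ _ (fun x : R * R => x - q) fst x).
    by apply: cvgB; [exact: cvg_id|exact: cvg_cst].
  exact: cvg_fst.
apply: (@continuous_comp _ _ _ (fun x : R * R => x - q) snd x).
  by apply: cvgB; [exact: cvg_id|exact: cvg_cst].
exact: cvg_snd.
Qed.

End Square.

Ltac plane_ring := apply: pair_ext; rewrite /= /GRing.scale /=; ring.

Section SquareRegion.
Context {R : realType}.
Local Open Scope classical_set_scope.

Lemma open_strip (q e : R * R) (k : R) :
  open [set x : R * R | 0 < dot (x - q) e < k].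
Proof.
rewrite (_ : [set x | _] = (fun x : R * R => dot (x - q) e) @^-1` `]0, k[%classic).
  have /continuousP : continuous (fun x : R * R => dot (x - q) e).
    exact: continuous_dot.
  by apply; exact: interval_open.
by apply/seteqP; split => x /=; rewrite in_itv.
Qed.

Lemma closed_strip (q e : R * R) (k : R) :
  closed [set x : R * R | 0 <= dot (x - q) e <= k].
Proof.
rewrite (_ : [set x | _] = (fun x : R * R => dot (x - q) e) @^-1` `[0, k]%classic).
  by apply: closed_comp => [x _|]; [exact: continuous_dot|exact: interval_closed].
by apply/seteqP; split => x /=; rewrite in_itv.
Qed.

(** The open square [Q] and the closed square [E] meet the complement of the
    boundary in the same set.  So [Q] is open and closed there, hence contains
    the component of each of its points, which is therefore bounded. *)
Lemma square_interior_sub (v : 'I_4 -> R * R) (i : 'I_4) (s r : R) :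
  is_square v -> 0 < s < 1 -> 0 < r < 1 ->
  poly_region v (v i + s *: side v i + r *: side v (ordS i)).
Proof.
move=> sqv s01 r01.
have [] := is_square_frame i sqv; set a := enorm _.
set e := side v i; set e' := side v (ordS i); set q := v i.
move=> a0 de de' dee' v1 v2 v3 s2 s3.
have a20 : 0 < a ^+ 2 by rewrite exprn_gt0.
have a2 : a ^+ 2 != 0 by rewrite gt_eqF.
have dot1 t u : dot (q + t *: e + u *: e' - q) e = t * a ^+ 2.
  rewrite (_ : _ - q = t *: e + u *: e');
    last by rewrite -(addrA q) addrAC subrr add0r.
  by rewrite dotDl !dotZl de (dotC e') dee' mulr0 addr0.
have dot2 t u : dot (q + t *: e + u *: e' - q) e' = u * a ^+ 2.
  rewrite (_ : _ - q = t *: e + u *: e');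
    last by rewrite -(addrA q) addrAC subrr add0r.
  by rewrite dotDl !dotZl de' dee' mulr0 add0r.
pose Q := [set x | 0 < dot (x - q) e < a ^+ 2] `&`
          [set x | 0 < dot (x - q) e' < a ^+ 2].
pose E := [set x | 0 <= dot (x - q) e <= a ^+ 2] `&`
          [set x | 0 <= dot (x - q) e' <= a ^+ 2].
have QE : Q `<=` E.
  by move=> x [/= /andP[x1 x2] /andP[x3 x4]]; split; rewrite /= !ltW.
have QB : Q `<=` ~` poly_boundary v.
  move=> x [/= x1 x2] [j _ [t _ xE]]; move: xE x1 x2; rewrite /side_pt.
  have [->|->|->|->] := ord4P i j.
  - have := dot2 t 0; rewrite scale0r addr0 mul0r => d <-.
    by rewrite d ltxx.
  - have := dot1 1 t; rewrite scale1r mul1r => d <-.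
    by rewrite v1 d ltxx andbF.
  - have := dot2 (1 - t) 1; rewrite scale1r mul1r => d <- _.
    rewrite (_ : _ + _ = q + (1 - t) *: e + e') ?d ?ltxx ?andbF//.
    by rewrite v2 s2; plane_ring.
  - have := dot1 0 (1 - t); rewrite scale0r addr0 mul0r => d <-.
    rewrite (_ : _ + _ = q + (1 - t) *: e') ?d ?ltxx//.
    by rewrite v3 s3; plane_ring.
have EB : E `&` ~` poly_boundary v `<=` Q.
  move=> x [[/= /andP[x1 x2] /andP[x3 x4]] xB].
  have xE := orthogonal_decomposition (x - q) a0 de de' dee'.
  move: xE x1 x2 x3 x4; set S := dot _ e; set T := dot _ e' => xE x1 x2 x3 x4.
  have {}xE : x = q + (S / a ^+ 2) *: e + (T / a ^+ 2) *: e'.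
    by rewrite -addrA -xE addrC subrK.
  have S01 : 0 <= S / a ^+ 2 <= 1 by rewrite ler_pdivrMr// mul1r x2 divr_ge0// ltW.
  have T01 : 0 <= T / a ^+ 2 <= 1 by rewrite ler_pdivrMr// mul1r x4 divr_ge0// ltW.
  have bnd j (t : R) : 0 <= t <= 1 -> x = v j + t *: side v j -> False.
    by move=> t01 xj; apply: xB; exists j => //; exists t; rewrite //= in_itv.
  have rev (t : R) : 0 <= t <= 1 -> 0 <= 1 - t <= 1 by lra.
  split => /=; rewrite !lt_neqAle ?x1 ?x2 ?x3 ?x4 !andbT; apply/andP; split;
    apply/eqP; rewrite -?/S -?/T => St; move: xE.
  - rewrite -St mul0r scale0r addr0 => xE.
    apply: (bnd (ordS (ordS (ordS i))) _ (rev _ T01)).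
      by rewrite v3 s3 [LHS]xE; plane_ring.
  - rewrite St divff// scale1r => xE; apply: (bnd (ordS i) _ T01).
    by rewrite v1.
  - rewrite -St mul0r scale0r addr0 => xE; exact: (bnd i _ S01).
  - rewrite St divff// scale1r => xE.
    apply: (bnd (ordS (ordS i)) _ (rev _ S01)).
    by rewrite v2 s2 [LHS]xE; plane_ring.
set x := (v i + _ + _).
have Qx : Q x.
  split; rewrite /= ?dot1 ?dot2; move: s01 r01 => /andP[? ?] /andP[? ?].
    by rewrite mulr_gt0// gtr_pMl.
  by rewrite mulr_gt0// gtr_pMl.
split; first exact: QB.
set C := connected_component _ x.
have CB : C `<=` ~` poly_boundary v by exact: connected_component_sub.
have CQ : C `&` Q = C.
  apply: (@component_connected _ (~` poly_boundary v) x).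
  - by exists x; split => //; apply: connected_component_refl; exact: QB.
  - by exists Q => //; apply: openI; exact: open_strip.
  - exists E; first by apply: closedI; exact: closed_strip.
    apply/seteqP; split => y [Cy Ey]; split => //; first exact: QE.
    by apply: EB; split => //; exact: CB.
rewrite -CQ; exists (`|q| + `|e| + `|e'|); split; first exact: num_real.
move=> M qM y [_ [/= /andP[y1 y2] /andP[y3 y4]]].
rewrite (le_trans _ (ltW qM))//.
have -> : y = q + (y - q) by rewrite addrC subrK.
rewrite (orthogonal_decomposition (y - q) a0 de de' dee') -addrA.
rewrite (le_trans (ler_normD _ _))// lerD2l (le_trans (ler_normD _ _))//.
by rewrite lerD// normrZ ler_piMl// ger0_norm ?divr_ge0 ?ltW//
  ltr_pdivrMr// mul1r.
Qed.

End SquareRegion.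

(** * The trace inequality on a square *)

(** The elementary bound [(y + z) ^+ 2 <= 2 * y ^+ 2 + 2 * z ^+ 2] replaces
    Minkowski's inequality: constant factors in the trace inequality are
    harmless. *)
Lemma ge0_integral_sqr_le d (T : measurableType d) (R : realType)
    (m : {measure set T -> \bar R}) (D : set T) (f g h : T -> R) :
  measurable D -> measurable_fun D f -> measurable_fun D g ->
  measurable_fun D h -> (forall x, f x = g x + h x \/ f x = g x - h x) ->
  (\int[m]_(x in D) (f x ^+ 2)%:E <=
   2%:E * \int[m]_(x in D) (g x ^+ 2)%:E +
   2%:E * \int[m]_(x in D) (h x ^+ 2)%:E)%E.
Proof.
move=> mD mf mg mh fgh.
have msq (k : T -> R) : measurable_fun D k ->
    measurable_fun D (fun x => (k x ^+ 2)%:E).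
  by move=> mk; apply/measurable_EFinP; exact: measurable_funX.
have sq0 (k : T -> R) x : D x -> (0 <= (k x ^+ 2)%:E)%E.
  by rewrite lee_fin sqr_ge0.
have sq20 (k : T -> R) x : D x -> (0 <= 2%:E * (k x ^+ 2)%:E)%E.
  by move=> _; rewrite mule_ge0 ?lee_fin ?sqr_ge0.
rewrite -!ge0_integralZl//; [|exact: msq|exact: sq0|exact: msq|exact: sq0].
rewrite -ge0_integralD//; last 4 first.
- exact: sq20.
- by apply: measurable_funeM; exact: msq.
- exact: sq20.
- by apply: measurable_funeM; exact: msq.
apply: ge0_le_integral => //.
- exact: sq0.
- exact: msq.
- by apply: emeasurable_funD; apply: measurable_funeM; exact: msq.
move=> x _; rewrite -!EFinM -EFinD lee_fin.
have h1 := sqr_ge0 (g x - h x); have h2 := sqr_ge0 (g x + h x).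
by case: (fgh x) => ->; nra.
Qed.

Section SquareTrace.
Context {R : realType}.
Local Open Scope classical_set_scope.
Local Notation mu := (@lebesgue_measure R).
Local Notation mu2 := (lebesgue2 R).

Lemma sq_integral_ge0 (D : set (R * R)) (f : R * R -> R) :
  (0 <= sq_integral D f)%E.
Proof. by apply: integral_ge0 => x _; rewrite lee_fin sqr_ge0. Qed.

Lemma ge0_integral_sqr_comb (D : set (R * R)) (f g h : R * R -> R) (a b : R) :
  measurable D -> continuous f -> continuous g -> continuous h ->
  0 <= a -> 0 <= b ->
  (\int[mu2]_(x in D) (a * f x ^+ 2 + b * (g x ^+ 2 + h x ^+ 2))%:E =
   a%:E * sq_integral D f +
   (b%:E * sq_integral D g + b%:E * sq_integral D h))%E.
Proof.
move=> mD cf cg ch a0 b0.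
have Z c (k : R * R -> R) : 0 <= c -> continuous k ->
    (c%:E * sq_integral D k = \int[mu2]_(x in D) (c * k x ^+ 2)%:E)%E.
  move=> c0 ck; rewrite -ge0_integralZl//.
  - apply: measurable_funTS; apply/measurable_EFinP.
    by apply: continuous_measurable2; exact: continuous_sqr.
  - by move=> x _; rewrite lee_fin sqr_ge0.
have Z0 c (k : R * R -> R) x : 0 <= c -> D x -> (0 <= (c * k x ^+ 2)%:E)%E.
  by move=> c0 _; rewrite lee_fin mulr_ge0// sqr_ge0.
have mZ c (k : R * R -> R) : continuous k ->
    measurable_fun D (fun x => (c * k x ^+ 2)%:E).
  move=> ck; apply: measurable_funTS; apply/measurable_EFinP.
  apply: continuous_measurable2 => x; apply: cvgM; first exact: cvg_cst.
  exact: continuous_sqr.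
rewrite (Z a f a0 cf) (Z b g b0 cg) (Z b h b0 ch).
rewrite -(ge0_integralD mu2 mD (fun x => @Z0 b g x b0) (mZ b g cg)
  (fun x => @Z0 b h x b0) (mZ b h ch)).
rewrite -(ge0_integralD mu2 mD (fun x => @Z0 a f x a0) (mZ a f cf)); last 2 first.
- by move=> x Dx; apply: adde_ge0; exact: Z0.
- by apply: emeasurable_funD; exact: mZ.
by apply: eq_integral => x _; rewrite -!EFinD mulrDr.
Qed.

Lemma integral_energy_density (w : R * R -> R) (D : set (R * R)) (eta k : R) :
  measurable D -> Ck 1 w -> 0 <= eta -> 0 <= k ->
  (\int[mu2]_(x in D) (energy_density w eta k x)%:E =
   (1 + eta^-1)%:E * sq_integral D w +
   ((eta * k)%:E * sq_integral D (partial1 w) +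
    (eta * k)%:E * sq_integral D (partial2 w)))%E.
Proof.
move=> mD [cw _ _ /= c1 c2] eta0 k0.
have e0 : 0 <= 1 + eta^-1 by rewrite addr_ge0// invr_ge0.
have ek0 : 0 <= eta * k by rewrite mulr_ge0.
exact: (ge0_integral_sqr_comb mD cw c1 c2 e0 ek0).
Qed.

(** Each side has length [a] and spans with the next one a parallelogram of area
    [a ^+ 2], so it contributes [a / a ^+ 2] times the integral. *)
Lemma square_trace_smooth (v : 'I_4 -> R * R) (w : R * R -> R) (eta : R)
    (a := enorm (side v ord0)) :
  is_square v -> Ck 1 w -> 0 < eta ->
  (boundary_integral v (fun x => w x ^+ 2)%R <=
   (4 / a)%:E * \int[mu2]_(x in poly_region v)
     (energy_density w eta (a ^+ 2) x)%:E)%E.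
Proof.
move=> sqv C1w eta0; set J := (\int[mu2]_(x in _) _)%E.
have [a0 _ _ _ _ _ _ _ _] := is_square_frame ord0 sqv; rewrite -/a in a0.
have J0 : (0 <= J)%E.
  apply: integral_ge0 => x _; rewrite lee_fin energy_density_ge0 ?ltW//.
  by rewrite exprn_gt0.
have sideJ (i : 'I_4) : ((enorm (side v i))%:E *
    \int[mu]_(s in `[0%R, 1%R]) (w (side_pt v i s) ^+ 2)%:E <=
    (a^-1)%:E * J)%E.
  have [_ de de' dee' _ _ _ _ _] := is_square_frame i sqv.
  rewrite -/a in de de' dee'.
  have := @trace_on_side _ w (v i) (side v i) (side v (ordS i)) _ _
    (poly_region_measurable v) (fun s r => @square_interior_sub _ v i s r sqv)
    C1w eta0.
  rewrite (orthogonal_det a0 de de' dee') de' -/J => /(lee_wpmul2l _) le.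
  have -> : enorm (side v i) = a^-1 * a ^+ 2.
    by case: sqv => _ sideE _; rewrite (sideE i ord0) -/a expr2 mulKf// gt_eqF.
  by rewrite EFinM -muleA; apply: le; rewrite lee_fin invr_ge0 ltW.
apply: (@le_trans _ _ (\sum_(i < 4) (a^-1)%:E * J)%E).
  by apply: lee_sum => i _; exact: sideJ.
rewrite !big_ord_recl big_ord0 adde0.
have ai0 : (0 <= (a^-1)%:E)%E by rewrite lee_fin invr_ge0 ltW.
rewrite -!ge0_muleDl ?adde_ge0//.
by rewrite -!EFinD (_ : _ + _ = 4 / a)//; ring.
Qed.

Lemma boundary_integral_sqr_le n (v : 'I_n -> R * R) (t w : R * R -> R) :
  continuous w -> in_L2_boundary v t ->
  (boundary_integral v (fun x => t x ^+ 2)%R <=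
   2%:E * boundary_integral v (fun x => w x ^+ 2)%R +
   2%:E * boundary_integral v (fun x => (w x - t x) ^+ 2)%R)%E.
Proof.
move=> cw [mt _].
have I0 i (f : R * R -> R) : (0 <= (enorm (side v i))%:E *
    \int[mu]_(s in `[0%R, 1%R]) (f (side_pt v i s) ^+ 2)%:E)%E.
  rewrite mule_ge0 ?lee_fin ?enorm_ge0//; apply: integral_ge0 => s _.
  by rewrite lee_fin sqr_ge0.
rewrite /boundary_integral !ge0_sume_distrr//; last first.
  by move=> i _; (exact: (I0 i w) || exact: (I0 i (fun x => w x - t x))).
rewrite -big_split/=; apply: lee_sum => i _.
rewrite !(muleCA 2%:E) -ge0_muleDr ?mule_ge0//; last 2 first.
- by apply: integral_ge0 => s _; rewrite lee_fin sqr_ge0.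
- by apply: integral_ge0 => s _; rewrite lee_fin sqr_ge0.
apply: lee_wpmul2l; first by rewrite lee_fin enorm_ge0.
have mw : measurable_fun (`[0%R, 1%R]%classic : set R) (w \o side_pt v i).
  apply: measurable_funTS; apply: continuous_measurable_fun.
  exact: continuous_line.
apply: (@ge0_integral_sqr_le _ _ _ mu `[0%R, 1%R]%classic (t \o side_pt v i)
  (w \o side_pt v i) (fun s => w (side_pt v i s) - t (side_pt v i s))) => //.
- exact: mt.
- exact: (measurable_funB mw (mt i)).
- by move=> s; right; rewrite opprB addrC subrK.
Qed.

(** The smooth case passes to the limit along the functions [w k] that define
    the trace.  Going from [t] to [w k] on the boundary and from [w k] back to
    [u] and [g] inside costs a factor 2 each, whence 16 in place of 4. *)
Lemma square_trace (v : 'I_4 -> R * R) (u t : R * R -> R) (g : R * R -> R * R)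
    (eta : R) (a := enorm (side v ord0)) :
  is_square v -> 0 < eta -> in_H1 (poly_region v) u g -> is_trace v u g t ->
  (boundary_integral v (fun x => t x ^+ 2)%R <=
   (16 / a * (1 + eta^-1))%:E * sq_integral (poly_region v) u +
   ((16 * eta * a)%:E * sq_integral (poly_region v) (fst \o g) +
    (16 * eta * a)%:E * sq_integral (poly_region v) (snd \o g)))%E.
Proof.
move=> sqv eta0 [[mu_ _] [mg1 _] [mg2 _] _] [tL2 [w [smw cvu cv1 cv2 cvt]]].
have [a0 _ _ _ _ _ _ _ _] := is_square_frame ord0 sqv; rewrite -/a in a0.
have mD := poly_region_measurable v.
set D := poly_region v in mu_ mg1 mg2 cvu cv1 cv2 mD *.
set c1 := 16 / a * _; set c2 := 16 * eta * a.
have c10 : 0 <= c1.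
  by rewrite mulr_ge0// ?divr_ge0 ?addr_ge0 ?invr_ge0// ltW.
have c20 : 0 <= c2 by rewrite !mulr_ge0// ltW.
set X := (_ + _)%E.
pose err k : \bar R :=
  ((c1%:E * sq_integral D (fun x => w k x - u x)%R +
   (c2%:E * sq_integral D (fun x => partial1 (w k) x - (g x).1)%R +
    c2%:E * sq_integral D (fun x => partial2 (w k) x - (g x).2)%R)) +
   2%:E * boundary_integral v (fun x => (w k x - t x) ^+ 2)%R)%E.
have err_cvg : err k @[k --> \oo] --> 0%E.
  have z c (f : nat -> \bar R) : f k @[k --> \oo] --> 0%E ->
      (c%:E * f k)%E @[k --> \oo] --> 0%E.
    by move=> f0; rewrite -(mule0 c%:E); exact: cvgeZl.
  have s0 (f f' : nat -> \bar R) : f k @[k --> \oo] --> 0%E ->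
      f' k @[k --> \oo] --> 0%E -> (f k + f' k)%E @[k --> \oo] --> 0%E.
    by move=> h h'; rewrite -(adde0 0%E); exact: cvgeD.
  by apply: (s0); [apply: (s0); [|apply: (s0)]|]; apply: (z).
have cvg_X : (X + err k)%E @[k --> \oo] --> X.
  have X0 : (0 <= X)%E.
    by rewrite !adde_ge0// mule_ge0// sq_integral_ge0.
  rewrite -[X in _ --> X]adde0; apply: cvgeD; [|exact: cvg_cst|exact: err_cvg].
  by rewrite fin_num_adde_defl.
apply: (cvge_to_ge cvg_X); apply: nearW => k.
have C1w : Ck 1 (w k) by exact: smw.
have [cw _ _ /= cw1 cw2] := C1w.
have bound (p q : R * R -> R) : continuous p -> measurable_fun D q ->
    (sq_integral D p <= 2%:E * sq_integral D q +
       2%:E * sq_integral D (fun x => p x - q x)%R)%E.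
  move=> cp mq; have mp : measurable_fun D p.
    by apply: measurable_funTS; exact: continuous_measurable2.
  apply: ge0_integral_sqr_le => //; first exact: measurable_funB.
  by move=> x; left; rewrite addrC subrK.
apply: (le_trans (boundary_integral_sqr_le cw tL2)).
rewrite /err addeA; apply: leeD2r.
apply: (@le_trans _ _ (2%:E * ((4 / a)%:E * \int[mu2]_(x in D)
     (energy_density (w k) eta (a ^+ 2) x)%:E))%E).
  by apply: lee_wpmul2l => //; exact: square_trace_smooth.
rewrite integral_energy_density//; [|exact: ltW|exact: sqr_ge0].
have half c (p q : R * R -> R) : 0 <= c -> continuous p -> measurable_fun D q ->
    ((c / 2)%:E * sq_integral D p <= c%:E * sq_integral D q +
       c%:E * sq_integral D (fun x => p x - q x)%R)%E.
  move=> c0 cp mq; have c20' : (0 <= (c / 2)%:E)%E by rewrite lee_fin divr_ge0.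
  apply: (le_trans (lee_wpmul2l c20' (bound _ _ cp mq))).
  rewrite ge0_muleDr ?mule_ge0 ?sq_integral_ge0// !muleA -!EFinM.
  by rewrite divfK.
(* Stated for arbitrary [x], [y] and [z]: on the integrals themselves,
   unification would start unfolding. *)
have coef (x y z : \bar R) : (0 <= x -> 0 <= y -> 0 <= z ->
    2%:E * ((4 / a)%:E * ((1 + eta^-1)%:E * x +
      ((eta * a ^+ 2)%:E * y + (eta * a ^+ 2)%:E * z))) =
    (c1 / 2)%:E * x + ((c2 / 2)%:E * y + (c2 / 2)%:E * z))%E.
  move=> x0 y0 z0.
  have b0 : (0 <= (1 + eta^-1)%:E * x)%E.
    by apply: mule_ge0 => //; rewrite lee_fin addr_ge0// invr_ge0 ltW.
  have ea0 : (0 <= (eta * a ^+ 2)%:E)%E.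
    by rewrite lee_fin mulr_ge0 ?sqr_ge0// ltW.
  have by0 := mule_ge0 ea0 y0; have bz0 := mule_ge0 ea0 z0.
  rewrite muleA -EFinM (ge0_muleDr _ b0 (adde_ge0 by0 bz0)).
  rewrite (ge0_muleDr _ by0 bz0) !muleA -!EFinM.
  congr (_%:E * _ + (_%:E * _ + _%:E * _))%E.
  - by rewrite /c1; field; rewrite !gt_eqF.
  - by rewrite /c2; field; rewrite gt_eqF.
  - by rewrite /c2; field; rewrite gt_eqF.
rewrite (coef _ _ _ (sq_integral_ge0 _ _) (sq_integral_ge0 _ _)
  (sq_integral_ge0 _ _)) /X addeACA [X in (_ <= _ + X)%E]addeACA.
apply: leeD; first exact: (half _ _ _ c10 cw mu_).
by apply: leeD; [exact: (half _ _ _ c20 cw1 mg1)|exact: (half _ _ _ c20 cw2 mg2)].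
Qed.

End SquareTrace.

(** * Bounds on the first Robin eigenvalue *)

Section RobinBounds.
Context {R : realType}.
Local Open Scope classical_set_scope.
Local Notation mu2 := (lebesgue2 R).

Lemma integral_enorm_sqr (D : set (R * R)) (g : R * R -> R * R) :
  measurable D -> measurable_fun D (fst \o g) -> measurable_fun D (snd \o g) ->
  (\int[mu2]_(x in D) (enorm (g x) ^+ 2)%:E =
   sq_integral D (fst \o g) + sq_integral D (snd \o g))%E.
Proof.
move=> mD m1 m2; rewrite /sq_integral -ge0_integralD//.
- by apply: eq_integral => x _; rewrite enorm_sqr -EFinD /dot -!expr2.
- by move=> x _; rewrite lee_fin sqr_ge0.
- by apply/measurable_EFinP; exact: measurable_funX.
- by move=> x _; rewrite lee_fin sqr_ge0.
- by apply/measurable_EFinP; exact: measurable_funX.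
Qed.

Lemma boundary_integral_ge0 n (v : 'I_n -> R * R) (f : R * R -> R) :
  (0 <= boundary_integral v (fun x => f x ^+ 2)%R)%E.
Proof.
apply: sume_ge0 => i _; rewrite mule_ge0 ?lee_fin ?enorm_ge0//.
by apply: integral_ge0 => s _; rewrite lee_fin sqr_ge0.
Qed.

(** The trace inequality is used with the weight [eta] for which [`|alpha|]
    times the coefficient [16 * eta * a] of the gradient is 1, so that the
    Dirichlet energy cancels from the Rayleigh quotient. *)
Lemma square_robin_lambda1_ge (v : 'I_4 -> R * R) (alpha : R)
    (a := enorm (side v ord0)) : is_square v -> alpha < 0 ->
  ((- (16 * `|alpha| / a + 256 * alpha ^+ 2))%:E <= robin_lambda1 v alpha)%E.
Proof.
move=> sqv alpha0; apply: le_ereal_inf_tmp => _ [u [g [t [H1 tr _ ->]]]].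
have [a0 _ _ _ _ _ _ _ _] := is_square_frame ord0 sqv; rewrite -/a in a0.
have b0 : 0 < `|alpha| by rewrite normr_gt0 lt_eqF.
have eta0 : 0 < (16 * a * `|alpha|)^-1 by rewrite invr_gt0 !mulr_gt0.
have := square_trace sqv eta0 H1 tr; rewrite -/a.
have [[_ Su] [mg1 S1] [mg2 S2] _] := H1; have [[_ Bt] _] := tr.
rewrite lee_fin /rayleigh_quotient integral_enorm_sqr//; last first.
  exact: poly_region_measurable.
have fnum (x : \bar R) : (0 <= x)%E -> (x < +oo)%E ->
    exists2 r : R, 0 <= r & x = r%:E.
  by case: x => [r r0 _| |]//; exists r.
have [s s0 ->] := fnum _ (sq_integral_ge0 _ _) Su.
have [g1 g10 ->] := fnum _ (sq_integral_ge0 _ _) S1.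
have [g2 g20 ->] := fnum _ (sq_integral_ge0 _ _) S2.
have [b bt0 ->] := fnum _ (boundary_integral_ge0 _ _) Bt.
rewrite -!EFinM -!EFinD lee_fin /= => trle.
(* If [u] had zero [L^2] norm, the quotient would be 0 by the convention for
   division by 0. *)
have [->|sn0] := eqVneq s 0.
  rewrite invr0 mulr0 oppr_le0; apply: addr_ge0.
    by apply: divr_ge0; [apply: mulr_ge0|exact: ltW].
  by apply: mulr_ge0; [exact: ler0n|exact: sqr_ge0].
have sp : 0 < s by rewrite lt_neqAle eq_sym sn0.
rewrite ler_pdivlMr//.
have alphaE : alpha = - `|alpha| by rewrite ltr0_norm// opprK.
move: trle b0; rewrite [in alpha ^+ 2]alphaE [in alpha * b]alphaE.
set k := `|alpha| => trle k0.
have := ler_wpM2l (ltW k0) trle.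
have -> : k * (16 / a * (1 + (16 * a * k)^-1^-1) * s +
    (16 * (16 * a * k)^-1 * a * g1 + 16 * (16 * a * k)^-1 * a * g2)) =
    (16 * k / a + 256 * k ^+ 2) * s + (g1 + g2).
  by field; rewrite !gt_eqF ?mulr_gt0.
by rewrite sqrrN; lra.
Qed.

Lemma square_perimeter (v : 'I_4 -> R * R) : is_square v ->
  perimeter v = 4 * enorm (side v ord0).
Proof.
move=> [_ sideE _]; rewrite /perimeter (eq_bigr (fun=> enorm (side v ord0))).
  by rewrite !big_ord_recl big_ord0; ring.
by move=> i _; exact: sideE.
Qed.

(** The region contains an open square of area [a ^+ 2], and it lies in the ball
    of radius [5 * a] for the max norm, since [5 * a] exceeds the perimeter; that
    ball has area [100 * a ^+ 2]. *)
Lemma square_side_area (v : 'I_4 -> R * R) (A : R)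
    (a := enorm (side v ord0)) : is_square v -> poly_area v = A%:E ->
  a ^+ 2 <= A <= 100 * a ^+ 2.
Proof.
move=> sqv areaA.
have [a0 de de' dee' _ _ _ _ _] := is_square_frame ord0 sqv.
rewrite -/a in a0 de de'.
have mD := poly_region_measurable v.
apply/andP; split.
  rewrite -lee_fin -areaA -(orthogonal_det a0 de de' dee').
  apply: (@parallelogram_area_le _ (v ord0)) => // s r s01 r01.
  exact: (@square_interior_sub _ v ord0 s r sqv s01 r01).
rewrite -lee_fin -areaA.
have -> : (100 * a ^+ 2)%:E = mu2 (ball (v ord0) (5 * a)).
  by rewrite ball_area ?mulr_gt0//; congr EFin; ring.
apply: le_measure; rewrite ?inE//; first exact: measurable_ball2.
move=> x /poly_region_dist; rewrite -ball_normE /ball_/= distrC => xP.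
apply: (le_lt_trans xP); rewrite square_perimeter//.
by rewrite ltr_pM2r// ltr_nat.
Qed.

Lemma smooth_cst (c : R) : smooth (cst c : R * R -> R).
Proof.
move=> k; elim: k c => [|k IH] c /=; first by move=> x; exact: cvg_cst.
have d0 v : (fun x : R * R => 'D_v (cst c : R * R -> R) x) = cst 0.
  by apply/funext => x; rewrite derive_cst.
split; [by move=> x; exact: cvg_cst|by move=> x; exact: derivable_cst|
  by move=> x; exact: derivable_cst| |].
- by rewrite /partial1 d0; exact: IH.
- by rewrite /partial2 d0; exact: IH.
Qed.

(** The test function is the constant 1, which is its own trace. *)
Lemma robin_lambda1_le (n : nat) (v : 'I_n -> R * R) (alpha A : R) :
  0 < A -> poly_area v = A%:E ->
  (robin_lambda1 v alpha <= (alpha * perimeter v / A)%:E)%E.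
Proof.
move=> A0 areaA; have mD := poly_region_measurable v.
set D := poly_region v in mD *.
have I0 (f : R * R -> R) : (forall x, f x = 0) -> sq_integral D f = 0%E.
  by move=> f0; apply: integral0_eq => x _; rewrite f0 expr0n.
have S1 : sq_integral D (cst 1) = A%:E.
  rewrite -areaA /poly_area -[RHS]mul1e -integral_cst//.
  by apply: eq_integral => x _; rewrite /= expr1n.
have B1 (f : R * R -> R) c : (forall x, f x = c) -> boundary_integral v f =
    (c * perimeter v)%:E.
  move=> fc; rewrite /perimeter mulr_sumr -sumEFin; apply: eq_bigr => i _.
  rewrite (eq_integral (cst c%:E)); last by move=> s _; rewrite fc.
  rewrite integral_cst//= lebesgue_measure_itv/= lte_fin ltr01 sube0 mule1.
  by rewrite -EFinM mulrC.
have B0 (f : R * R -> R) : (forall x, f x = 0) -> boundary_integral v f = 0%E.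
  by move=> /B1 ->; rewrite mul0r.
apply: ereal_inf_lbound; exists (cst 1), (cst (0, 0)), (cst 1); split.
- split.
  + by split; [exact: measurable_cst|rewrite S1 ltry].
  + by split; [exact: measurable_cst|rewrite I0// ltry].
  + by split; [exact: measurable_cst|rewrite I0// ltry].
  + exact: weak_gradient_one.
- split.
    split; first by move=> i; exact: measurable_cst.
    by rewrite (B1 _ 1) ?ltry// => x; rewrite /= expr1n.
  exists (fun=> cst 1); split.
  + by move=> k; exact: smooth_cst.
  + apply: cvg_near_cst; apply: nearW => k; rewrite I0// => x.
    by rewrite /= subrr.
  + apply: cvg_near_cst; apply: nearW => k; rewrite I0// => x.
    by rewrite /partial1 derive_cst /= subrr.
  + apply: cvg_near_cst; apply: nearW => k; rewrite I0// => x.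
    by rewrite /partial2 derive_cst /= subrr.
  + apply: cvg_near_cst; apply: nearW => k; rewrite B0// => x.
    by rewrite /= subrr expr0n.
- move=> [N [mN N0 DN]].
  have : (mu2 D <= mu2 N)%E.
    apply: le_measure; rewrite ?inE// => x Dx; apply: DN => /= /(_ Dx) /eqP.
    by rewrite oner_eq0.
  by rewrite N0 -/(poly_area v) areaA lee_fin leNgt A0.
- congr EFin; rewrite /rayleigh_quotient S1 (B1 _ 1) /=; last first.
    by move=> x; rewrite /= expr1n.
  rewrite integral0_eq ?add0r ?mul1r//= => x _.
  by rewrite enorm_sqr /dot mul0r addr0.
Qed.

End RobinBounds.

(** * The Hausdorff distance up to isometry *)

Section Hausdorff.
Context {R : realType}.
Local Open Scope classical_set_scope.

Lemma closure_norm_le (S : set (R * R)) (q : R * R) (c : R) :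
  (forall x, S x -> `|x - q| <= c) ->
  forall x, closure S x -> `|x - q| <= c.
Proof.
move=> Sq; pose B := (fun x : R * R => `|x - q|) @^-1` `]-oo, c]%classic.
have cB : closed B.
  apply: closed_comp => [x _|]; last exact: interval_closed.
  apply: (@continuous_comp _ _ _ (fun x : R * R => x - q) Num.norm x).
    by apply: cvgB; [exact: cvg_id|exact: cvg_cst].
  exact: norm_continuous.
have SB : S `<=` B by move=> x Sx; rewrite /B /= in_itv/= Sq.
by move=> x; rewrite closureE => /(_ B (conj cB SB)); rewrite /B /= in_itv.
Qed.

(** A translation brings a point of [T] onto a point [q] of [S], and every point
    of either set is then close to [q].  The factor 2 compares the Euclidean
    norm with the max norm. *)
Lemma hausdorff_dist_iso_le (S T : set (R * R)) (b : R) :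
  S !=set0 -> T !=set0 ->
  (forall x y, S x -> S y -> `|x - y| <= b) ->
  (forall x y, T x -> T y -> `|x - y| <= b) ->
  (hausdorff_dist_iso S T <= (2 * b)%:E)%E.
Proof.
move=> [q Sq] [p Tp] diamS diamT.
pose f (x : R * R) := x + (q - p).
have isof : plane_isometry f.
  by move=> x y; congr enorm; rewrite /f opprD addrACA subrr addr0.
have fTq : (f @` T) q by exists p => //; rewrite /f addrC subrK.
have cS : forall x, closure S x -> `|x - q| <= b.
  by apply: closure_norm_le => x Sx; exact: diamS.
have cT : forall x, closure (f @` T) x -> `|x - q| <= b.
  apply: closure_norm_le => _ [x Tx <-].
  by rewrite /f -addrA addrAC subrr add0r; exact: diamT.
have dist_le x y : `|x - y| <= b -> ((eucl_dist x y)%:E <= (2 * b)%:E)%E.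
  move=> xy; rewrite lee_fin; apply: (le_trans (enorm_le_norm _)).
  by rewrite ler_pM2l.
apply: (@le_trans _ _ (hausdorff_dist (closure S) (closure (f @` T)))).
  by apply: ereal_inf_lbound; exists f.
rewrite /hausdorff_dist ge_max; apply/andP; split.
  apply: ge_ereal_sup => _ [x Sx <-]; apply: ge_ereal_inf.
  exists (eucl_dist x q)%:E; first by exists q => //; exact: subset_closure.
  by apply: dist_le; exact: cS.
apply: ge_ereal_sup => _ [y Ty <-]; apply: ge_ereal_inf.
exists (eucl_dist q y)%:E; first by exists q => //; exact: subset_closure.
by apply: dist_le; rewrite distrC; exact: cT.
Qed.

Lemma poly_region_nonempty n (v : 'I_n -> R * R) (A : R) :
  0 < A -> poly_area v = A%:E -> poly_region v !=set0.
Proof.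
move=> A0 areaA; apply/set0P; apply/eqP => D0.
by move: areaA; rewrite /poly_area D0 measure0 => -[/eqP]; rewrite lt_eqF.
Qed.

Lemma poly_region_diam n (v : 'I_n.+1 -> R * R) x y :
  poly_region v x -> poly_region v y -> `|x - y| <= 2 * perimeter v.
Proof.
move=> /poly_region_dist dx /poly_region_dist; rewrite distrC => dy.
rewrite -(subrK (v ord0) x) -addrA (le_trans (ler_normD _ _))//.
by rewrite mulrDl mul1r lerD.
Qed.

End Hausdorff.

(** * Comparison of the eigenvalues *)

Theorem theorem3 (R : realType) (A alpha : R) (hA : 0 < A)
    (halpha : alpha < 0) :
  exists C : R, forall v0 v : 'I_4 -> R * R,
    is_square v0 -> poly_area v0 = A%:E ->
    simple_polygon v -> poly_area v = A%:E ->
    (C%:E < hausdorff_dist_iso (poly_region v) (poly_region v0))%E ->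
    (robin_lambda1 v alpha <= robin_lambda1 v0 alpha)%E.
Proof.
(* [- K] bounds the eigenvalue of every square of area [A] from below, using
   that its side is at least a tenth of the square root of [A]. *)
pose K := 160 * `|alpha| / Num.sqrt A + 256 * alpha ^+ 2.
(* The first term makes [alpha * perimeter v / A] at most [- K]; the second one
   rules out that the distance comes from the diameter of the square itself. *)
exists (Num.max (4 * (K * A / `|alpha|)) (16 * Num.sqrt A)).
move=> v0 v sqv0 area0 _ area dist.
have [a0 _ _ _ _ _ _ _ _] := is_square_frame ord0 sqv0.
have := square_side_area sqv0 area0; have := square_perimeter sqv0.
have := square_robin_lambda1_ge sqv0 halpha.
move: a0; set a := enorm _ => a0 lower per0 /andP[aA Aa].
have k0 : 0 < `|alpha| by rewrite normr_gt0 lt_eqF.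
have sA0 : 0 < Num.sqrt A by rewrite sqrtr_gt0.
have a_le : a <= Num.sqrt A.
  by rewrite -[a]ger0_norm ?(ltW a0)// -sqrtr_sqr ler_wsqrtr.
have a_ge : Num.sqrt A <= 10 * a.
  rewrite -[10 * a]ger0_norm ?mulr_ge0 ?(ltW a0)// -sqrtr_sqr ler_wsqrtr//.
  by rewrite exprMn (le_trans Aa)// (_ : 10 ^+ 2 = 100)//; ring.
apply: (le_trans (robin_lambda1_le alpha hA area)); apply: le_trans lower.
have perK : K * A / `|alpha| <= perimeter v.
  rewrite leNgt; apply/negP => perK; move: dist; apply/negP; rewrite -leNgt.
  apply: (le_trans (hausdorff_dist_iso_le (b := 2 * Num.max (perimeter v) (4 * a))
    (poly_region_nonempty hA area) (poly_region_nonempty hA area0) _ _)).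
  - move=> x y Dx Dy; apply: (le_trans (poly_region_diam Dx Dy)).
    by rewrite ler_pM2l// le_max lexx.
  - move=> x y Dx Dy; apply: (le_trans (poly_region_diam Dx Dy)).
    by rewrite ler_pM2l// le_max per0 lexx orbT.
  rewrite lee_fin !maxr_pMr// ge_max; apply/andP.
  by split; rewrite le_max; apply/orP; [left|right]; lra.
rewrite lee_fin.
have le1 : 16 * `|alpha| / a <= 160 * `|alpha| / Num.sqrt A.
  rewrite ler_pdivrMr// mulrAC ler_pdivlMr//.
  rewrite (_ : 160 * `|alpha| * a = 16 * `|alpha| * (10 * a)); last by ring.
  by rewrite ler_pM2l// mulr_gt0.
apply: (@le_trans _ _ (- K)); last by rewrite lerN2 /K lerD2r.
have -> : alpha * perimeter v / A = - (`|alpha| * perimeter v / A).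
  by rewrite ltr0_norm// !mulNr opprK.
rewrite lerN2 ler_pdivlMr// mulrC.
by move: perK; rewrite ler_pdivrMr// mulrC [perimeter v * _]mulrC.
Qed.
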